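(* There is a constant $c>0$ such that, for all integers $r\geq 2$, $\alpha\geq 1$, and $z\geq 168\cdot\alpha\cdot r\log r$, the following holds: if a connected graph with at least $z$ edges is $(\alpha,2r-1)$-loosely connected and has $\theta_{r}$-girth at least $z$, then it contains as a minor a clique of size $k$, for some integer $k$ with $$k\geq \frac{2^{c\cdot\frac{z}{r\alpha}}}{\sqrt{rz}}.$$
   Context: Graphs are finite, undirected, loopless, and may have multiple edges. $H$ is a minor of $G$ if $H$ can be obtained from $G$ by vertex removals, edge removals and edge contractions (parallel edges arising from contractions are kept, loops are discarded). An $H$-model in $G$ is a subgraph of $G$ that contains $H$ as a minor. The $H$-girth of $G$ is the minimum number of edges of an $H$-model in $G$, and is $\infty$ if $G$ does not contain $H$ as a minor. $\theta_r$ is the graph with two vertices and $r$ parallel edges. For $\alpha,\beta\in\mathbb{N}$, a graph $G$ is $(\alpha,\beta)$-loosely connected if for every $A,B\subseteq V(G)$ such that $V(G)=A\cup B$ and $G$ has no edge between $A\setminus B$ and $B\setminus A$, we have: $|A\cap B|<\beta$ implies $\min(|A\setminus B|,|B\setminus A|)\leq\alpha$. Logarithms are binary. *)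

(* Defs.v *)
From Stdlib Require Import Relation_Operators.
From mathcomp Require Import all_boot all_order all_algebra.
From mathcomp Require Import classical_sets reals constructive_ereal ereal.
From mathcomp Require Import topology normedtype exp.

Set Implicit Arguments.
Unset Strict Implicit.
Unset Printing Implicit Defensive.

Import Order.TTheory GRing.Theory Num.Theory.

Section Multigraph.
Variables V E : finType.

(* The vertices and edges of a graph are subsets of ambient finite types, so  *)
(* that deletions and contractions do not change the types; the value of ends *)
(* outside eset is irrelevant.                                                *)
Record mgraph := MGraph {
  vset : {set V};
  eset : {set E};
  ends : E -> {set V};
  endsP : [forall e in eset, (ends e \subset vset) && (#|ends e| == 2)]
}.

Implicit Types G S : mgraph.

Definition adj G : rel V :=
  [rel x y | [exists e in eset G, ends G e == [set x; y]%SET]].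

Definition connected_mgraph G : Prop :=
  {in vset G &, forall x y, connect (adj G) x y}.

Definition subgraph S G : Prop :=
  [/\ vset S \subset vset G, eset S \subset eset G
    & {in eset S, ends S =1 ends G}].

Definition loosely_connected (alpha beta : nat) G : Prop :=
  forall A B : {set V},
    vset G = A :|: B ->
    {in A :\: B & B :\: A, forall x y, ~~ adj G x y} ->
    #|A :&: B| < beta ->
    minn #|A :\: B| #|B :\: A| <= alpha.

Fact del_vertex_subproof G x :
  [forall e in [set e in eset G | x \notin ends G e]%SET,
    (ends G e \subset (vset G :\ x)%SET) && (#|ends G e| == 2)].
Proof.
apply/forall_inP => e; rewrite inE => /andP[eG xe].
by have /andP[sub ->] := forall_inP (endsP G) e eG; rewrite subsetD1 sub xe.
Qed.

Definition del_vertex G x := MGraph (del_vertex_subproof G x).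

Fact del_edge_subproof G e :
  [forall f in (eset G :\ e)%SET,
    (ends G f \subset vset G) && (#|ends G f| == 2)].
Proof.
apply/forall_inP => f; rewrite in_setD1 => /andP[_ fG].
exact: (forall_inP (endsP G)).
Qed.

Definition del_edge G e := MGraph (del_edge_subproof G e).

Definition merge_vertex (x y v : V) : V := if v == y then x else v.

Fact contract_subproof G x y :
  [forall f in [set f in eset G | #|merge_vertex x y @: ends G f| == 2]%SET,
    ((merge_vertex x y @: ends G f)%SET
       \subset (merge_vertex x y @: vset G)%SET)
    && (#|(merge_vertex x y @: ends G f)%SET| == 2)].
Proof.
apply/forall_inP => f; rewrite inE => /andP[fG ->]; rewrite andbT.
by have /andP[sub _] := forall_inP (endsP G) f fG; rewrite imsetS.
Qed.

(* Keeping only the edges that still have two ends discards the loops. *)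
Definition contract G x y := MGraph (contract_subproof G x y).

Inductive minor_step G : mgraph -> Prop :=
| VertexRemoval x of x \in vset G : minor_step G (del_vertex G x)
| EdgeRemoval e of e \in eset G : minor_step G (del_edge G e)
| EdgeContraction e x y of e \in eset G & ends G e = [set x; y]%SET :
    minor_step G (contract G x y).

End Multigraph.

Definition mgraph_iso (V E V' E' : finType)
    (G : mgraph V E) (H : mgraph V' E') : Prop :=
  exists (f : {x | x \in vset G} -> {x | x \in vset H})
         (g : {e | e \in eset G} -> {e | e \in eset H}),
    [/\ bijective f, bijective g
      & forall x e,
          (val (f x) \in ends H (val (g e))) = (val x \in ends G (val e))].

Definition minor (V' E' V E : finType)
    (H : mgraph V' E') (G : mgraph V E) : Prop :=
  exists2 G' : mgraph V E,
    clos_refl_trans (mgraph V E) (@minor_step V E) G G' & mgraph_iso G' H.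

Fact theta_subproof (r : nat) :
  [forall e in [set: 'I_r]%SET, ([set: bool]%SET \subset [set: bool]%SET)
    && (#|[set: bool]%SET| == 2)].
Proof. by apply/forall_inP => e _; rewrite subxx cardsT card_bool. Qed.

Definition theta (r : nat) : mgraph bool 'I_r := MGraph (theta_subproof r).

Fact clique_subproof (k : nat) :
  [forall e in [set e : {set 'I_k} | #|e| == 2]%SET,
    (e \subset [set: 'I_k]%SET) && (#|e| == 2)].
Proof. by apply/forall_inP => e; rewrite inE finset.subsetT. Qed.

Definition clique (k : nat) : mgraph 'I_k {set 'I_k} :=
  MGraph (ends := id) (clique_subproof k).

Local Open Scope ring_scope.

(* ereal_inf is +oo on the empty set; on a nonempty set of natural numbers *)
(* it is the minimum.                                                      *)
Definition girth (R : realType) (V' E' V E : finType)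
    (H : mgraph V' E') (G : mgraph V E) : \bar R :=
  ereal_inf [set (#|eset S|%:R)%:E
            | S in [set S : mgraph V E | subgraph S G /\ minor H S]]%classic.

Definition log2 (R : realType) (x : R) : R := ln x / ln 2.

(* Main.v *)
Require Import Defs.
From Stdlib Require Import Relation_Operators.
From mathcomp Require Import all_boot zify.

Set Implicit Arguments.
Unset Strict Implicit.
Unset Printing Implicit Defensive.

(** Why the theorem holds.  As r >= 2, the bound on z gives z >= 168 alpha r.
    Put R = z / (8 r).

    Two disjoint connected sets that are joined by r edges contain a theta_r
    model: connect the ends of these edges inside each set.  If both sets are
    trees of height at most 2R this costs about 4rR <= z/2 further edges, which
    is less than z.  So large theta_r-girth says that any two such shallow
    pieces are joined by fewer than r edges ([few_between_reach]).

    Choose a maximal set X of vertices at pairwise distance more than 2R, and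
    cut the graph into breadth-first trees rooted in X ([packing_exists],
    [forest_exists]).  These clusters have height at most 2R, and an edge that
    leaves its cluster starts at height at least R ([exit_height]).  The subtree
    below any vertex sends fewer than r edges to the rest of its cluster.
    Hence a slice of a cluster, the part below v and not below a descendant p
    lying alpha + 1 levels deeper, sends at most 2r - 2 edges to the rest of the
    cluster.  It has more than alpha vertices, so by loose connectivity it also
    has an edge to another cluster ([slice_exit]); that edge starts at height at
    least R, which yields a second branch down to height R that avoids p.  Thus
    the number of branches doubles every alpha + 1 levels and a cluster sends
    out 2^m edges with m about R / (alpha + 1) ([many_exits]).  Fewer than r of
    them go to the same cluster, so the contracted clusters form a graph of
    minimum degree about 2^m / r ([cluster_degree]).

    A graph of minimum degree d has a clique minor of order about sqrt d
    ([clique_of_family]).  Among all minors take one with the largest ratio of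
    edges to vertices.  In the neighbourhood of a vertex of least degree every
    vertex sees about half of the others.  Hence of any three vertices there,
    two have many common neighbours; this yields k vertices that have many
    common neighbours in pairs, and a private common neighbour for each pair
    completes a clique minor.  With d about 2^m / r and k^2 about d, the factor
    sqrt (r z) in the statement absorbs r, and a small constant in the exponent
    absorbs the numerical constants ([clique_order_bound]).

    Loose connectivity lets a slice be large if what remains outside it is
    small, that is, if almost all vertices are within distance 2R of one vertex
    x.  This is excluded in [many_far_vertices].  All subtrees of the
    breadth-first tree of x would be cut off by fewer than r edges, so that the
    graph has more than 168 alpha vertices.  If it has more than
    2 (alpha + r) vertices, the tree has a vertex p whose removal leaves only
    parts of at most alpha vertices, because each tree edge separates a small
    part; some of these parts form, without p, a connected set with between
    alpha and 2 alpha vertices and fewer than r outgoing edges, against loose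
    connectivity ([sparse_absurd]).  If it has at most 2 (alpha + r) vertices,
    any two disjoint sets of more than alpha vertices are adjacent, so almost
    every bipartition is essentially one into connected sets and is crossed by
    fewer than r edges; averaging over bipartitions bounds the number of edges
    by 10 alpha r ([dense_absurd]). *)

(** * Connected vertex sets *)

Lemma disjoint_mem (T : finType) (P Q : {set T}) :
  (forall v, v \in P -> v \notin Q) -> [disjoint P & Q].
Proof. by move=> PQ; apply/pred0P=> v /=; apply/negP=> /andP[/PQ/negP]. Qed.

Lemma disjointDr (T : finType) (P Q : {set T}) : [disjoint P & Q :\: P].
Proof. by apply: disjoint_mem => v vP; rewrite inE vP. Qed.

Lemma subset_of_card (T : finType) (A : {set T}) k : k <= #|A| ->
  exists2 B : {set T}, B \subset A & #|B| = k.
Proof.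
move=> kA; have : 0 < #|[set B : {set T} | B \subset A & #|B| == k]|.
  by rewrite cards_draws bin_gt0.
by case/card_gt0P=> B; rewrite inE => /andP[BA /eqP Bk]; exists B.
Qed.

Lemma card_bigcup_le (I J : finType) (A : {set I}) (F : I -> {set J}) c :
  (forall i, i \in A -> #|F i| <= c) -> #|\bigcup_(i in A) F i| <= #|A| * c.
Proof.
move=> Fc; apply: (@leq_trans (\sum_(i in A) c)); last by rewrite sum_nat_const.
apply: (@leq_trans (\sum_(i in A) #|F i|)); last exact: leq_sum.
elim/big_rec2: _ => [|i n B _ IH]; first by rewrite cards0.
by apply: leq_trans (leq_card_setU _ _).1 _; rewrite leq_add2l.
Qed.

Section ConnSets.
Variables (V : finType) (e : rel V).
Implicit Types P Q U C : {set V}.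

(** Connectedness by cuts instead of paths: this form is stable under
    contraction and lets a set grow by one crossing edge at a time. *)
Definition connset P : bool :=
  (P != set0) && [forall U : {set V},
    (U != set0) && (U \proper P) ==>
      [exists u in U, exists w in P :\: U, e u w]].

Lemma connset_neq0 P : connset P -> P != set0.
Proof. by case/andP. Qed.

Lemma connset_cross P U u0 w0 : connset P ->
    u0 \in P -> u0 \in U -> w0 \in P -> w0 \notin U ->
  exists u w, [/\ u \in P, u \in U, w \in P, w \notin U & e u w].
Proof.
case/andP=> _ /forallP/(_ (P :&: U)) Pc u0P u0U w0P w0U.
have : (P :&: U != set0) && (P :&: U \proper P).
  apply/andP; split; first by apply/set0Pn; exists u0; rewrite inE u0P.
  by apply/properP; split; [exact: subsetIl | exists w0; rewrite // inE w0P].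
move/(implyP Pc)=> /exists_inP[u]; rewrite inE => /andP[uP uU].
case/exists_inP=> w; rewrite !inE => /andP[+ wP] euw; rewrite wP /= => wU.
by exists u, w.
Qed.

Hypothesis esym : symmetric e.

(** As the relation is symmetric, the side of a cut that contains a given
    vertex may be chosen. *)
Lemma connset_intro a P : a \in P ->
    (forall U w0, a \in U -> w0 \in P -> w0 \notin U ->
      exists u w, [/\ u \in P, u \in U, w \in P, w \notin U & e u w]) ->
  connset P.
Proof.
move=> aP H; apply/andP; split; first by apply/set0Pn; exists a.
apply/forallP=> U; apply/implyP=> /andP[/set0Pn[u0 u0U] /properP[/subsetP UP [w0 w0P w0U]]].
have [aU|aU] := boolP (a \in U).
  have [u [w [uP uU wP wU euw]]] := H U w0 aU w0P w0U.
  by apply/exists_inP; exists u => //; apply/exists_inP; exists w; rewrite // inE wU.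
have := H (~: U) u0; rewrite !inE negbK => /(_ aU (UP _ u0U) u0U).
move=> [u [w []]]; rewrite !inE negbK => uP uU wP wU euw.
apply/exists_inP; exists w => //; apply/exists_inP; exists u; first by rewrite inE uU.
by rewrite esym.
Qed.

Lemma connset1 a : connset [set a].
Proof.
apply: (@connset_intro a); first exact: set11.
by move=> U w0 aU /set1P->; rewrite aU.
Qed.

Definition nb P Q : bool := [exists u in P, exists w in Q, e u w].

Lemma nbP P Q : reflect (exists u w, [/\ u \in P, w \in Q & e u w]) (nb P Q).
Proof.
apply: (iffP exists_inP) => [[u uP /exists_inP[w wQ euw]]|[u [w [uP wQ euw]]]].
  by exists u, w.
by exists u => //; apply/exists_inP; exists w.
Qed.

Lemma nb_sym P Q : nb P Q = nb Q P.
Proof.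
by apply/nbP/nbP=> -[u [w [uP wQ euw]]]; exists w, u; rewrite esym.
Qed.

Lemma nbUl P P' Q : nb (P :|: P') Q = nb P Q || nb P' Q.
Proof.
apply/nbP/orP=> [[u [w [/setUP[uP|uP] wQ euw]]]|[]/nbP[u [w [uP wQ euw]]]].
- by left; apply/nbP; exists u, w.
- by right; apply/nbP; exists u, w.
- by exists u, w; rewrite inE uP.
- by exists u, w; rewrite inE uP orbT.
Qed.

(** A cut that does not split the core has to split one of the connected
    pieces hooked to it, or an edge between the core and a piece. *)
Lemma connset_hook C P : connset C -> C \subset P ->
    (forall w, w \in P -> exists Q, [/\ connset Q, Q \subset P, w \in Q
                                       & (exists2 x, x \in C & x \in Q) \/ nb C Q]) ->
  connset P.
Proof.
move=> Cc /subsetP CP H; have /set0Pn[a aC] := connset_neq0 Cc.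
apply: (connset_intro (CP a aC)) => U w0 aU w0P w0U.
have [/subsetP CU|/subsetPn[c cC cU]] := boolP (C \subset U); last first.
  have [u [w [uC uU wC wU euw]]] := connset_cross Cc aC aU cC cU.
  by exists u, w; rewrite !CP.
have [Q [Qc /subsetP QP w0Q]] := H w0 w0P.
suff inQ x : x \in Q -> x \in U -> exists u w,
    [/\ u \in P, u \in U, w \in P, w \notin U & e u w].
  case=> [[x xC xQ]|/nbP[u [w [uC wQ euw]]]]; first by apply: inQ xQ (CU x xC).
  have [wU|wU] := boolP (w \in U); first exact: inQ wQ wU.
  by exists u, w; split; auto.
move=> xQ xU; have [u [w [uQ uU wQ wU euw]]] := connset_cross Qc xQ xU w0Q w0U.
by exists u, w; rewrite !QP.
Qed.

Lemma connsetU P Q : connset P -> connset Q -> nb P Q -> connset (P :|: Q).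
Proof.
move=> Pc Qc PQ; apply: (connset_hook Pc) => [|w]; first exact: subsetUl.
case/setUP=> [wP|wQ].
  by exists P; split; rewrite ?subsetUl //; left; exists w.
by exists Q; split; rewrite ?subsetUr //; right.
Qed.

End ConnSets.

Lemma connset_edge_mono (V : finType) (e e' : rel V) (P : {set V}) :
    {in P &, forall u w, e u w -> e' u w} -> connset e P -> connset e' P.
Proof.
move=> ee' /andP[P0 /forallP Pc]; rewrite /connset P0 /=; apply/forallP=> U.
apply/implyP=> UP; have /exists_inP[u uU /exists_inP[w wPU euw]] := implyP (Pc U) UP.
apply/exists_inP; exists u => //; apply/exists_inP; exists w => //.
case/andP: UP => _ /proper_sub/subsetP UP.
by apply: ee' => //; [apply: UP | case/setDP: wPU].
Qed.

Section Graph.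
Variables (V E : finType).
Implicit Types (G : mgraph V E) (P Q : {set V}).

Lemma adjP G x y :
  reflect (exists2 a, a \in eset G & ends G a = [set x; y]) (adj G x y).
Proof.
apply: (iffP exists_inP) => -[a aG /eqP xy]; exists a => //; exact/eqP.
Qed.

Lemma adj_sym G : symmetric (adj G).
Proof.
by move=> x y; apply/adjP/adjP=> -[a aG xy]; exists a; rewrite // xy setUC.
Qed.

Lemma ends_vset G a x : a \in eset G -> x \in ends G a -> x \in vset G.
Proof. by move=> aG; have /andP[/subsetP + _] := forall_inP (endsP G) a aG; apply. Qed.

Lemma card_ends G a : a \in eset G -> #|ends G a| = 2.
Proof. by move=> aG; have /andP[_ /eqP] := forall_inP (endsP G) a aG. Qed.

Lemma ends_eq2 G a x y : a \in eset G -> x \in ends G a -> y \in ends G a ->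
  x != y -> ends G a = [set x; y].
Proof.
move=> aG xa ya xy; apply/esym/eqP; rewrite eqEcard card_ends // cards2 xy andbT.
by apply/subsetP=> v /set2P[]->.
Qed.

Lemma adj_vset G x y : adj G x y -> (x \in vset G) * (y \in vset G).
Proof.
by case/adjP=> a aG xy; split; apply: (ends_vset aG); rewrite xy !inE eqxx ?orbT.
Qed.

Lemma adj_neq G x y : adj G x y -> x != y.
Proof.
case/adjP=> a aG xy; have := card_ends aG; rewrite xy cards2.
by case: (x == y).
Qed.

Lemma connset_vset G : connected_mgraph G -> vset G != set0 ->
  connset (adj G) (vset G).
Proof.
move=> Gc /set0Pn[a aG]; apply: (connset_intro (@adj_sym G) aG).
move=> U w0 aU w0G w0U; have /connectP[p pa w0E] := Gc a w0 aG w0G.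
elim: p a aU aG pa w0E => [|b p IH] a aU aG /=; first by move=> _ w0E; rewrite -w0E (negPf w0U) in aU.
case/andP=> ab pb w0E; have bG := (adj_vset ab).2.
have [bU|bU] := boolP (b \in U); first exact: IH pb w0E.
by exists a, b.
Qed.

End Graph.

Section Model.
Variables (V E V' E' : finType) (H : mgraph V' E').

Record model (G : mgraph V E) (phi : V' -> {set V}) (g : E' -> E) : Prop := Model {
  model_sub : forall x, x \in vset H -> phi x \subset vset G;
  model_conn : forall x, x \in vset H -> connset (adj G) (phi x);
  model_disj : {in vset H &, forall x y v, v \in phi x -> v \in phi y -> x = y};
  model_edge : forall f, f \in eset H -> g f \in eset G;
  model_inj : {in eset H &, injective g};
  model_ends : forall f x, f \in eset H -> x \in ends H f ->
    exists2 v, v \in phi x & v \in ends G (g f)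
}.

Lemma model_ends2 G phi g f : model G phi g -> f \in eset H ->
  exists x y u v, [/\ ends H f = [set x; y], x != y, u \in phi x, v \in phi y
     & ends G (g f) = [set u; v]].
Proof.
move=> M fH; have /cards2P[x [y [xy fE]]] : #|ends H f| == 2 by rewrite card_ends.
have xf : x \in ends H f by rewrite fE !inE eqxx.
have yf : y \in ends H f by rewrite fE !inE eqxx orbT.
have [u ux uf] := model_ends M fH xf; have [v vy vf] := model_ends M fH yf.
exists x, y, u, v; split=> //; apply: ends_eq2 => //; first exact: model_edge M _ fH.
apply: contraNneq xy => uv; apply/eqP.
by apply: (model_disj M) (ends_vset fH xf) (ends_vset fH yf) _ ux _; rewrite uv.
Qed.

Lemma model_vset G phi g f v : model G phi g -> f \in eset H ->
   v \in ends G (g f) -> exists2 x, x \in ends H f & v \in phi x.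
Proof.
move=> M fH; have [y [z [u [w [fE yz uy wz ->]]]]] := model_ends2 M fH.
by rewrite fE; case/set2P=> ->; [exists y | exists z]; rewrite // !inE eqxx ?orbT.
Qed.

Lemma model_del_vertex G phi g v : model G phi g ->
  (forall x, x \in vset H -> v \notin phi x) -> model (del_vertex G v) phi g.
Proof.
move=> M vphi; have edgeP f : f \in eset H -> g f \in eset (del_vertex G v).
  move=> fH; rewrite inE (model_edge M) //=; apply/negP=> /(model_vset M fH)[x xf vx].
  by have := vphi x (ends_vset fH xf); rewrite vx.
split=> //.
- by move=> x xH; rewrite subsetD1 vphi // (model_sub M).
- move=> x xH; apply: connset_edge_mono (model_conn M xH) => a b ax bx /adjP[f fG fE].
  apply/adjP; exists f => //; rewrite inE fG /= fE.
  apply/negP=> /set2P[] vE; have := vphi x xH; rewrite vE ?ax ?bx //.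
- exact: model_disj M.
- exact: model_inj M.
- exact: model_ends M.
Qed.

(** An edge that represents an edge of H joins two different branch sets, so
    contracting inside one branch set never turns it into a loop. *)
Lemma model_contract G phi g z x y : model G phi g -> z \in vset H ->
  x \in phi z -> y \in phi z -> 
  model (contract G x y) (fun w => merge_vertex x y @: phi w) g.
Proof.
move=> M zH xz yz; set m := merge_vertex x y.
have mz w v : w \in vset H -> v \in phi w -> m v \in phi w.
  rewrite /m /merge_vertex; case: eqP => // -> wH yw.
  by rewrite -(model_disj M zH wH yz yw).
have edgeP f : f \in eset H -> g f \in eset (contract G x y).
  move=> fH; rewrite inE (model_edge M) //=.
  have [a [b [u [v [fE ab ua vb ->]]]]] := model_ends2 M fH.
  have aH : a \in vset H by apply: (ends_vset fH); rewrite fE !inE eqxx.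
  have bH : b \in vset H by apply: (ends_vset fH); rewrite fE !inE eqxx orbT.
  rewrite imsetU1 imset_set1 cards2 (contra_neq _ ab) // => muv.
  by apply: (model_disj M aH bH (mz a u aH ua)); rewrite [m u]muv; apply: mz.
split=> //.
- by move=> w wH; apply: imsetS; apply: model_sub M _ wH.
- move=> w wH; have wc := model_conn M wH; have /set0Pn[a aw] := connset_neq0 wc.
  have aw' : m a \in m @: phi w by apply: imset_f.
  apply: (connset_intro (@adj_sym _ _ _) aw') => U v aU /imsetP[b bw ->] bU.
  have := @connset_cross _ _ _ (m @^-1: U) a b wc aw; rewrite !inE => /(_ aU bw bU).
  move=> [u1 [u2 []]]; rewrite !inE => u1w u1U u2w u2U /adjP[f fG fE].
  exists (m u1), (m u2); split=> //; try exact: imset_f.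
  have mE : m @: ends G f = [set m u1; m u2] by rewrite fE imsetU1 imset_set1.
  apply/adjP; exists f => //; rewrite inE fG /= -/m mE cards2.
  by rewrite (contraTneq _ u1U) // => ->.
- move=> w w' wH w'H v /imsetP[a aw ->] /imsetP[b bw' mab].
  by apply: (model_disj M wH w'H (mz w a wH aw)); rewrite mab; apply: mz.
- exact: model_inj M.
- move=> f w fH wf; have [v vw vf] := model_ends M fH wf.
  by exists (m v); apply: imset_f.
Qed.

Lemma model_del_edge G phi g f0 : model G phi g ->
  (forall x, x \in vset H -> #|phi x| <= 1) -> f0 \notin g @: eset H ->
  model (del_edge G f0) phi g.
Proof.
move=> M phi1 f0g; split.
- exact: model_sub M.
- move=> x xH; have /set0Pn[a ax] := connset_neq0 (model_conn M xH).
  have -> : phi x = [set a].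
    by apply/esym/eqP; rewrite eqEcard sub1set ax cards1 phi1.
  by apply: connset1; apply: adj_sym.
- exact: model_disj M.
- move=> f fH; rewrite !inE (model_edge M) // andbT.
  by apply: contraNneq f0g => <-; apply: imset_f.
- exact: model_inj M.
- exact: model_ends M.
Qed.

Lemma model_iso G phi g : model G phi g ->
    (forall x, x \in vset H -> #|phi x| <= 1) ->
    (forall v, v \in vset G -> exists2 x, x \in vset H & v \in phi x) ->
    (forall a, a \in eset G -> a \in g @: eset H) ->
  mgraph_iso G H.
Proof.
move=> M phi1 phiS gS.
have fP (v : {v | v \in vset G}) : exists x : {x | x \in vset H}, val v \in phi (val x).
  by case: v => v vG; have [x xH vx] := phiS v vG; exists (exist _ x xH).
have gP (a : {a | a \in eset G}) : exists f : {f | f \in eset H}, val a == g (val f).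
  by case: a => a aG; have /imsetP[f fH aE] := gS a aG; exists (exist _ f fH); apply/eqP.
pose F v := xchoose (fP v); pose K a := xchoose (gP a).
have FP v : val v \in phi (val (F v)) by exact: xchooseP (fP v).
have KP a : val a = g (val (K a)) by apply/eqP; exact: xchooseP (gP a).
have F'P (x : {x | x \in vset H}) : exists v : {v | v \in vset G}, val v \in phi (val x).
  case: x => x xH; have /set0Pn[v vx] := connset_neq0 (model_conn M xH).
  by exists (exist _ v (subsetP (model_sub M xH) v vx)).
pose F' x := xchoose (F'P x).
have F'xP x : val (F' x) \in phi (val x) by exact: xchooseP (F'P x).
have phi_uniq x u v : x \in vset H -> u \in phi x -> v \in phi x -> u = v.
  by move=> xH ux vx; apply: (card_le1_eqP (phi1 x xH)).
exists F, K; split.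
- exists F' => [v|x]; apply/val_inj.
    by apply: (phi_uniq (val (F v))) => //; exact: valP.
  by apply: (model_disj M) (FP (F' x)) (F'xP x); exact: valP.
- exists (fun f => exist (fun a => a \in eset G) (g (val f)) (model_edge M (valP f))) => [a|f]; apply/val_inj.
    by rewrite /= -KP.
  by apply: (model_inj M); [exact: valP | exact: valP | rewrite -KP].
- move=> v a; have aH := valP (K a).
  have [x [y [u [w [fE xy ux wy gE]]]]] := model_ends2 M aH.
  have xH : x \in vset H by apply: (ends_vset aH); rewrite fE !inE eqxx.
  have yH : y \in vset H by apply: (ends_vset aH); rewrite fE !inE eqxx orbT.
  rewrite fE [val a]KP gE !inE.
  have E1 (s : V') (t : V) : s \in vset H -> t \in phi s -> (val (F v) == s) = (val v == t).
    move=> sH ts; apply/eqP/eqP=> [Fs|vt].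
      by apply: (phi_uniq s) => //; rewrite -Fs.
    apply: (model_disj M) (FP v) _ => //; [exact: valP | by rewrite vt].
  by rewrite (E1 x u) // (E1 y w).
Qed.

(** Induction on the number of vertices and edges: delete a vertex outside all
    branch sets, else contract an edge inside a branch set, else delete an edge
    that represents nothing.  If none of these applies, G is a copy of H. *)
Lemma minor_model G phi g : model G phi g -> minor H G.
Proof.
have [n] := ubnP (#|vset G| + #|eset G|); elim: n => // n IH in G phi *.
move=> nG M.
have step G' phi' : minor_step G G' -> model G' phi' g ->
    #|vset G'| + #|eset G'| < #|vset G| + #|eset G| -> minor H G.
  move=> GG' M' lt; have [|G'' G'G'' iso] := IH G' phi' _ M'.
    exact: leq_trans lt nG.
  by exists G'' => //; apply: rt_trans (rt_step _ _ _ _ GG') G'G''.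
have [/exists_inP[v vG /forall_inP vphi]|/exists_inPn allphi] :=
    boolP [exists v in vset G, [forall x in vset H, v \notin phi x]].
  apply: step (VertexRemoval vG) (model_del_vertex M vphi) _.
  rewrite -addSn leq_add //=; first by rewrite [leqRHS](cardsD1 v) vG.
  by apply: subset_leq_card; apply/subsetP=> f; rewrite inE => /andP[].
have [/exists_inP[z zH /card_gt1P[a [b [az bz ab]]]]|/exists_inPn phi1] :=
    boolP [exists z in vset H, 1 < #|phi z|].
  have [|u [w [uz _ wz wU /adjP[f fG fE]]]] :=
    @connset_cross _ _ _ [set a] a b (model_conn M zH) az (set11 _) bz.
    by rewrite inE eq_sym.
  have uw : u != w by apply: (@adj_neq _ _ G); apply/adjP; exists f.
  have uG : u \in vset G by apply: (subsetP (model_sub M zH)).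
  have wG : w \in vset G by apply: (subsetP (model_sub M zH)).
  apply: step (EdgeContraction fG fE) (model_contract M zH uz wz) _.
  rewrite -addSn leq_add //=; last first.
    by apply: subset_leq_card; apply/subsetP=> f'; rewrite inE => /andP[].
  rewrite [leqRHS](cardsD1 w) wG ltnS; apply: subset_leq_card.
  apply/subsetP=> v /imsetP[v' v'G ->]; rewrite /merge_vertex !inE.
  by case: (eqVneq v' w) => [_|v'w]; rewrite ?uw ?uG ?v'w.
have phi1' x : x \in vset H -> #|phi x| <= 1 by move=> xH; rewrite leqNgt phi1.
have [/exists_inP[f fG fg]|/exists_inPn gS] :=
    boolP [exists f in eset G, f \notin g @: eset H].
  apply: step (EdgeRemoval fG) (model_del_edge M phi1' fg) _.
  by rewrite -addnS leq_add2l /= [leqRHS](cardsD1 f) fG.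
exists G; first exact: rt_refl.
apply: (model_iso M phi1') => [v vG|a aG]; last by have := gS a aG; rewrite negbK.
by have /forall_inPn[x xH] := allphi v vG; rewrite negbK; exists x.
Qed.

End Model.

Lemma clique_minor (V E : finType) (G : mgraph V E) k (B : 'I_k -> {set V}) :
    eset G != set0 ->
    (forall i, B i \subset vset G) -> (forall i, connset (adj G) (B i)) ->
    (forall i j v, v \in B i -> v \in B j -> i = j) ->
    (forall i j, i != j -> nb (adj G) (B i) (B j)) ->
  minor (clique k) G.
Proof.
(* a0 is only the value of the edge map on sets that are not edges *)
case/set0Pn=> a0 _ BG Bc Bd Badj.
have gP (f : {set 'I_k}) : exists a : E, #|f| == 2 -> a \in eset G /\
    (forall x, (x \in f) <-> exists2 v, v \in B x & v \in ends G a).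
  have [/cards2P[i [j [ij ->]]]|f2] := boolP (#|f| == 2); last by exists a0.
  have /nbP[u [w [ui wj /adjP[a aG aE]]]] := Badj i j ij.
  exists a => _; split=> // x; rewrite aE; split.
    by case/set2P=> ->; [exists u | exists w]; rewrite // !inE eqxx ?orbT.
  case=> v vx /set2P[] vE; rewrite vE in vx.
    by rewrite (Bd _ _ _ vx ui) !inE eqxx.
  by rewrite (Bd _ _ _ vx wj) !inE eqxx orbT.
have [g gE] := fin_all_exists gP.
apply: (@minor_model _ _ _ _ _ _ B g); split=> //.
- by move=> i j _ _ v; apply: Bd.
- by move=> f; rewrite inE => /gE[].
- move=> f f'; rewrite !inE => /gE[_ fE] /gE[_ f'E] ff'; apply/setP=> x.
  by apply/idP/idP=> [/fE|/f'E] H; [apply/f'E; rewrite -ff' | apply/fE; rewrite ff'].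
- by move=> f x; rewrite inE => /gE[_ fE] /fE.
Qed.

(** * Edges between two connected sets *)

Section Girth.
Variables (V E : finType) (G : mgraph V E).
Implicit Types (P Q W : {set V}) (D B : {set E}).

Definition between P Q : {set E} :=
  [set a in eset G | (ends G a :&: P != set0) && (ends G a :&: Q != set0)].

Lemma betweenP P Q a : [disjoint P & Q] ->
  reflect (exists u w, [/\ u \in P, w \in Q, a \in eset G & ends G a = [set u; w]])
          (a \in between P Q).
Proof.
move=> PQ; rewrite inE; apply: (iffP and3P) => [[aG]|[u [w [uP wQ aG ->]]]].
  move=> /set0Pn[u /setIP[ua uP]] /set0Pn[w /setIP[wa wQ]].
  exists u, w; split=> //; apply: ends_eq2 => //.
  by apply: contraTneq wQ => <-; rewrite (disjointFr PQ uP).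
by split=> //; apply/set0Pn; [exists u | exists w]; rewrite !inE eqxx ?orbT.
Qed.

Lemma betweenC P Q : between P Q = between Q P.
Proof. by apply/setP=> a; rewrite !inE; case: (a \in _); rewrite //= andbC. Qed.

Lemma betweenS P P' Q Q' : P \subset P' -> Q \subset Q' -> between P Q \subset between P' Q'.
Proof.
move=> /setIS PP' /setIS QQ'; apply/subsetP=> a; rewrite !inE => /and3P[->].
move=> /set0Pn[u /(subsetP (PP' _)) uP] /set0Pn[w /(subsetP (QQ' _)) wQ] /=.
by apply/andP; split; apply/set0Pn; [exists u | exists w].
Qed.

Lemma nb_between P Q : [disjoint P & Q] -> nb (adj G) P Q = (between P Q != set0).
Proof.
move=> PQ; apply/nbP/set0Pn=> [[u [w [uP wQ /adjP[a aG aE]]]]|[a /(betweenP _ PQ)[u [w [uP wQ aG aE]]]]].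
  by exists a; apply/(betweenP _ PQ); exists u, w.
by exists u, w; split=> //; apply/adjP; exists a.
Qed.

Definition adj_in D : rel V := [rel x y | [exists a in D, ends G a == [set x; y]]].

Lemma adj_in_sym D : symmetric (adj_in D).
Proof. by move=> x y; apply: eq_existsb => a; rewrite setUC. Qed.

Lemma connset_adj_in D D' P : D \subset D' -> connset (adj_in D) P -> connset (adj_in D') P.
Proof.
move/subsetP=> DD'; apply: connset_edge_mono => u w _ _ /exists_inP[a aD aE].
by apply/exists_inP; exists a; rewrite // DD'.
Qed.

(** The edges of a spanning tree, grown one vertex and one crossing edge at a
    time. *)
Lemma spanning_edges P : connset (adj G) P ->
  exists D, [/\ D \subset eset G, forall a, a \in D -> ends G a \subset P,
                #|D| < #|P| & connset (adj_in D) P].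
Proof.
move=> Pc; have /set0Pn[a aP] := connset_neq0 Pc.
have grow n : n <= #|P| -> exists (U : {set V}) D, [/\ a \in U, U \subset P,
    [/\ D \subset eset G, forall a, a \in D -> ends G a \subset U,
                #|D| < #|U| & connset (adj_in D) U] & n <= #|U|].
  elim: n => [|n IH] nP.
    exists [set a], set0; rewrite sub1set set11 sub0set cards0 cards1.
    by do 2!split=> //; [move=> b; rewrite inE | apply: connset1; exact: adj_in_sym].
  have [U [D [aU UP [DG Dend DU Uc] nU]]] := IH (ltnW nP).
  have [PU|/subsetPn[b bP bU]] := boolP (P \subset U).
    by exists U, D; split=> //; apply: leq_trans nP (subset_leq_card PU).
  have [u [w [uP uU wP wU /adjP[f fG fE]]]] := connset_cross Pc aP aU bP bU.
  exists (w |: U), (f |: D); split.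
  - by rewrite inE aU orbT.
  - by rewrite subUset sub1set wP.
  - split.
    + by rewrite subUset sub1set fG.
    + move=> c /setU1P[->|cD].
        by rewrite fE; apply/subsetP=> v /set2P[]->; rewrite !inE ?uU ?eqxx ?orbT.
      exact: subset_trans (Dend c cD) (subsetUr _ _).
    + rewrite !cardsU1 wU; apply: leq_ltn_trans (leq_add (leq_b1 _) (leqnn _)) _.
      by rewrite ltn_add2l.
    + rewrite [w |: U]setUC; apply: connsetU; first exact: adj_in_sym.
      * exact: connset_adj_in (subsetUr _ _) Uc.
      * by apply: connset1; exact: adj_in_sym.
      apply/nbP; exists u, w; split; rewrite ?set11 //.
      by apply/exists_inP; exists f; rewrite ?setU11 // fE.
  - by rewrite cardsU1 wU add1n ltnS.
have [U [D [_ UP [DG Dend DU Uc] PU]]] := grow _ (leqnn _).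
have <- : U = P by apply/eqP; rewrite eqEcard UP.
by exists D.
Qed.

(** Spanning trees of P and Q, together with the edges of B, form the model;
    its size does not involve the other edges inside P and Q. *)
Lemma theta_minor r P Q B : P \subset vset G -> Q \subset vset G ->
    [disjoint P & Q] -> connset (adj G) P -> connset (adj G) Q ->
    B \subset between P Q -> #|B| = r ->
  exists S : mgraph V E, [/\ subgraph S G, minor (theta r) S
                            & #|eset S| + 2 <= #|P| + #|Q| + r].
Proof.
move=> PG QG PQ Pc Qc /subsetP BPQ Br; subst r.
have [DP [DPG DPe DPl DPc]] := spanning_edges Pc.
have [DQ [DQG DQe DQl DQc]] := spanning_edges Qc.
have Send : [forall e in DP :|: DQ :|: B, (ends G e \subset P :|: Q) && (#|ends G e| == 2)].
  apply/forall_inP=> a /setUP[/setUP[aP|aQ]|aB].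
  - rewrite (subset_trans (DPe a aP) (subsetUl _ _)) card_ends //.
    exact: (subsetP DPG).
  - rewrite (subset_trans (DQe a aQ) (subsetUr _ _)) card_ends //.
    exact: (subsetP DQG).
  - have /(betweenP _ PQ)[u [w [uP wQ aG aE]]] := BPQ a aB.
    rewrite card_ends // andbT aE; apply/subsetP=> v.
    by case/set2P=> ->; rewrite inE ?uP ?wQ ?orbT.
exists (MGraph Send); split.
- split=> //=; rewrite !subUset ?PG ?QG ?DPG ?DQG //=.
  by apply/subsetP=> a /BPQ; rewrite inE => /andP[].
- apply: (@minor_model _ _ _ _ (theta #|B|) _ (fun b : bool => if b then P else Q)
           (fun i : 'I_#|B| => enum_val i)); split=> /=.
  + by case=> _; rewrite ?subsetUl ?subsetUr.
  + case=> _.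
      apply: (@connset_adj_in DP (DP :|: DQ :|: B)) => //.
      by rewrite -setUA subsetUl.
    apply: (@connset_adj_in DQ (DP :|: DQ :|: B)) => //.
    by rewrite setUAC subsetUr.
  + move=> [] [] _ _ v //= vP; first by rewrite (disjointFr PQ vP).
    by move/(disjointFr PQ); rewrite vP.
  + by move=> f _; rewrite inE enum_valP orbT.
  + by move=> i j _ _; apply: enum_val_inj.
  + move=> i b _ _; have /(betweenP _ PQ)[u [w [uP wQ aG ->]]] := BPQ _ (enum_valP i).
    by case: b; [exists u | exists w]; rewrite // !inE eqxx ?orbT.
- have := leq_trans (leq_card_setU (DP :|: DQ) B).1 (leq_add (leq_card_setU DP DQ).1 (leqnn _)).
  rewrite /=; lia.
Qed.

Section HighGirth.
Variables (r z : nat).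
Hypothesis girth_ge : forall S : mgraph V E,
  subgraph S G -> minor (theta r) S -> z <= #|eset S|.

Lemma few_between P Q : P \subset vset G -> Q \subset vset G ->
    [disjoint P & Q] -> connset (adj G) P -> connset (adj G) Q ->
    #|P| + #|Q| + r < z + 2 -> #|between P Q| < r.
Proof.
move=> PG QG PQ Pc Qc lt_z; rewrite ltnNge; apply/negP=> r_le.
have [B BPQ Br] := subset_of_card r_le.
have [S [SG rS cS]] := theta_minor PG QG PQ Pc Qc BPQ Br.
have := girth_ge SG rS; lia.
Qed.

(** In a tree of height H this holds with s about r * H, however many
    vertices the tree has; s is what P contributes to the size of a theta model. *)
Definition reach s P := forall W, W \subset P -> #|W| <= r ->
  exists P', [/\ W \subset P', P' \subset P, connset (adj G) P' & #|P'| <= s].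

Lemma reach_card s P : connset (adj G) P -> #|P| <= s -> reach s P.
Proof. by move=> Pc Ps W WP _; exists P. Qed.

(** Only the ends of r chosen edges have to be connected inside P and inside
    Q, so that the theta model stays small even if P and Q are huge. *)
Lemma few_between_reach s t P Q : P \subset vset G -> Q \subset vset G ->
    [disjoint P & Q] -> reach s P -> reach t Q ->
    s + t + r < z + 2 -> #|between P Q| < r.
Proof.
move=> PG QG PQ Ps Qt lt_z; rewrite ltnNge; apply/negP=> r_le.
have [B BPQ Br] := subset_of_card r_le.
have shadow (P0 : {set V}) s0 : reach s0 P0 ->
    (forall a, a \in B -> ends G a :&: P0 != set0) ->
    exists P', [/\ P' \subset P0, connset (adj G) P', #|P'| <= s0
                  & forall a, a \in B -> ends G a :&: P' != set0].
  move=> P0s BP0; have [a0 a0B|B0] := pickP (mem B); last first.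
    have [||P' [_ P'P P'c P's]] := P0s set0; rewrite ?sub0set ?cards0 //.
    by exists P'; split=> // a aB; have := B0 a; rewrite /= aB.
  have /set0Pn[u0 _] := BP0 a0 a0B.
  pose f a := odflt u0 [pick u in ends G a :&: P0].
  have fP a : a \in B -> f a \in ends G a :&: P0.
    by rewrite /f => /BP0/set0Pn[u uP]; case: pickP => [//|/(_ u)]; rewrite uP.
  have [||P' [WP' P'P P'c P's]] := P0s (f @: B).
  - by apply/subsetP=> u /imsetP[a aB ->]; have /setIP[] := fP a aB.
  - by rewrite -Br leq_imset_card.
  exists P'; split=> // a aB; apply/set0Pn; exists (f a).
  have /setIP[fa _] := fP a aB.
  by rewrite inE fa (subsetP WP') ?imset_f.
have BP a : a \in B -> ends G a :&: P != set0.
  by move/(subsetP BPQ); rewrite inE => /and3P[].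
have BQ a : a \in B -> ends G a :&: Q != set0.
  by move/(subsetP BPQ); rewrite inE => /and3P[].
have [P' [P'P P'c P's BP']] := shadow P s Ps BP.
have [Q' [Q'Q Q'c Q't BQ']] := shadow Q t Qt BQ.
have : #|between P' Q'| < r.
  apply: few_between P'c Q'c _; first exact: subset_trans PG.
  - exact: subset_trans QG.
  - exact: disjointWl P'P (disjointWr Q'Q PQ).
  - by apply: leq_ltn_trans lt_z; rewrite !leq_add.
rewrite ltnNge -Br subset_leq_card //; apply/subsetP=> a aB.
rewrite inE BP' // BQ' // !andbT.
by have := subsetP BPQ a aB; rewrite inE => /andP[].
Qed.

End HighGirth.
End Girth.

(** * Close elements in dense relations *)

(** Greedy choice: a set with at least as many elements as there are indices
    always has an element that is not yet taken. *)
Lemma distinct_representatives (I : eqType) (T : finType) (t0 : T) (A : I -> {set T}) (s : seq I) :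
    uniq s -> (forall i, i \in s -> size s <= #|A i|) ->
  exists f : I -> T, {in s &, injective f} /\ {in s, forall i, f i \in A i}.
Proof.
elim: s => [|i s IH] /=; first by move=> _ _; exists (fun=> t0).
case/andP=> is_ us As; have [|f [finj fA]] := IH us.
  by move=> j js; apply: leq_trans (As j _); rewrite ?inE ?js ?orbT.
have [|t tAi tf] := @subsetPn _ (mem (A i)) (mem [seq f j | j <- s]) _.
  apply/negP=> /subset_leq_card le.
  by have := leq_trans (As i (mem_head _ _)) (leq_trans le (card_size _)); rewrite size_map ltnn.
have E j : j \in s -> (j == i) = false by move=> js; apply: contraNF is_ => /eqP <-.
exists (fun j => if j == i then t else f j); split.
  move=> j j' /predU1P[->|js] /predU1P[->|j's]; rewrite ?eqxx ?E //.
  - by move=> tE; case/negP: tf; rewrite tE map_f.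
  - by move=> tE; case/negP: tf; rewrite -tE map_f.
  - exact: finj.
move=> j /predU1P[->|js]; rewrite ?eqxx // E //; exact: fA.
Qed.

(** If some element is unrelated to k others, these are pairwise related, as
    there are no three pairwise unrelated elements.  Otherwise every choice
    rules out at most k elements and a greedy choice succeeds. *)
Lemma clique_of_no_anticlique3 (T : finType) (c : rel T) (N : {set T}) k :
    symmetric c ->
    (forall x y w, x \in N -> y \in N -> w \in N -> x != y -> x != w -> y != w ->
       [|| c x y, c x w | c y w]) ->
    k * k <= #|N| ->
  exists2 K : {set T}, K \subset N & #|K| = k /\ {in K &, forall x y, x != y -> c x y}.
Proof.
move=> csym c3 kN; have [->|k_gt0] := posnP k.
  by exists set0; rewrite ?sub0set ?cards0 //; split=> // x y; rewrite inE.
pose far x := [set y in N | (y != x) && ~~ c x y].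
have [/exists_inP[x xN /subset_of_card[K Kx Kk]]|/exists_inPn few] :=
    boolP [exists x in N, k <= #|far x|].
  have KP y : y \in K -> [/\ y \in N, y != x & ~~ c x y].
    by move/(subsetP Kx); rewrite inE => /and3P[].
  exists K; first by apply/subsetP=> y /KP[].
  split=> // y w /KP[yN yx cxy] /KP[wN wx cxw] yw.
  have := c3 x y w xN yN wN; rewrite (negPf cxy) (negPf cxw) /=.
  by apply; rewrite // eq_sym.
suff greedy j (W : {set T}) : W \subset N -> j * k <= #|W| ->
    exists2 K : {set T}, K \subset W & #|K| = j /\ {in K &, forall x y, x != y -> c x y}.
  exact: greedy.
elim: j W => [|j IH] W WN jW.
  by exists set0; rewrite ?sub0set ?cards0 //; split=> // x y; rewrite inE.
have [W0|[x xW]] := set_0Vmem W; first by move: jW; rewrite W0 cards0; lia.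
have xN := subsetP WN x xW; have := few x xN; rewrite -ltnNge => far_lt.
pose W' := [set y in W | (y != x) && c x y].
have [||K KW' [Kj Kc]] := IH W'.
- by apply/subsetP=> y; rewrite inE => /andP[/(subsetP WN)].
- have : #|W| <= #|x |: (far x :|: W')|.
    apply: subset_leq_card; apply/subsetP=> y yW; rewrite !inE yW (subsetP WN) //=.
    by case: eqP => //=; case: (c x y).
  have := (leq_card_setU (far x) W').1; have := cardsU1 x (far x :|: W').
  by have := leq_b1 (x \notin far x :|: W'); lia.
have KP y : y \in K -> [/\ y \in W, y != x & c x y].
  by move/(subsetP KW'); rewrite inE => /and3P[].
have xK : x \notin K by apply/negP=> /KP[]; rewrite eqxx.
exists (x |: K); first by apply/subsetP=> y /setU1P[->|/KP[]].
split=> [|y w]; first by rewrite cardsU1 xK Kj.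
case/setU1P=> [->|yK] /setU1P[->|wK] yw; first by rewrite eqxx in yw.
- by have [] := KP w wK.
- by rewrite csym; have [] := KP y yK.
- exact: Kc.
Qed.

Section Degrees.
Variables (T : finType) (a : rel T).
Hypotheses (asym : symmetric a) (airr : irreflexive a).
Implicit Types (F S : {set T}).

Definition nbrs F x := [set y in F | a x y].
Definition degsum F := \sum_(x in F) #|nbrs F x|.

Lemma degsumU1 x F : x \notin F -> degsum (x |: F) = degsum F + 2 * #|nbrs F x|.
Proof.
move=> xF; rewrite /degsum big_setU1 //=.
have -> : nbrs (x |: F) x = nbrs F x.
  by apply/setP=> y; rewrite !inE; case: eqP => // ->; rewrite airr !andbF.
have -> : \sum_(y in F) #|nbrs (x |: F) y| = \sum_(y in F) (#|nbrs F y| + a x y).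
  apply: eq_bigr => y yF; have [axy|axy] := boolP (a x y).
    have -> : nbrs (x |: F) y = x |: nbrs F y.
      by apply/setP=> w; rewrite !inE; case: eqP => // ->; rewrite asym axy.
    by rewrite cardsU1 inE (negPf xF) addnC.
  rewrite addn0; congr #|pred_of_set _|; apply/setP=> w; rewrite !inE.
  by case: eqP => // ->; rewrite asym (negPf axy) !andbF.
rewrite big_split /= -big_mkcondr /=.
have -> : \sum_(y in F | a x y) 1 = #|nbrs F x| by rewrite -sum1_card; apply: eq_bigl => y; rewrite inE.
lia.
Qed.

(** Three subsets of S, each with about half of its elements, must overlap. *)
Lemma common_of_three S x y w :
    {in S, forall u, #|S| <= 2 * #|nbrs S u| + 2} ->
    x \in S -> y \in S -> w \in S ->
  [|| #|S| <= 6 * #|nbrs S x :&: nbrs S y| + 6,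
      #|S| <= 6 * #|nbrs S x :&: nbrs S w| + 6
    | #|S| <= 6 * #|nbrs S y :&: nbrs S w| + 6].
Proof.
move=> Sdeg xS yS wS; set X := nbrs S x; set Y := nbrs S y; set W := nbrs S w.
have := Sdeg x xS; have := Sdeg y yS; have := Sdeg w wS; rewrite -/X -/Y -/W.
have : #|X :|: Y :|: W| <= #|S|.
  by apply: subset_leq_card; apply/subsetP=> u; rewrite !inE -!andb_orr => /andP[].
have := cardsUI (X :|: Y) W; have := cardsUI X Y.
have : #|(X :|: Y) :&: W| <= #|X :&: W| + #|Y :&: W|.
  by rewrite setIUl; exact: (leq_card_setU _ _).1.
lia.
Qed.

Lemma close_clique S k :
    {in S, forall u, #|S| <= 2 * #|nbrs S u| + 2} -> 6 * (k * k + k + 2) <= #|S| ->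
  exists2 K : {set T}, K \subset S & #|K| = k /\
    {in K &, forall x y, x != y -> k * k <= #|(nbrs S x :&: nbrs S y) :\: K|}.
Proof.
move=> Sdeg Sk; pose c x y := #|S| <= 6 * #|nbrs S x :&: nbrs S y| + 6.
have [|||K KS [Kk Kc]] := @clique_of_no_anticlique3 T c S k.
- by move=> x y; rewrite /c setIC.
- by move=> x y w xS yS wS _ _ _; exact: common_of_three.
- by apply: leq_trans Sk; lia.
exists K => //; split=> // x y xK yK xy; have := Kc x y xK yK xy; rewrite /c.
have := cardsID K (nbrs S x :&: nbrs S y).
have := subset_leq_card (subsetIr (nbrs S x :&: nbrs S y) K).
rewrite Kk; lia.
Qed.

End Degrees.

(** * Clique minors in dense families of branch sets *)

(** Comparing the quotients p x / q x in cross-multiplied form is transitive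
    only where q is positive, hence the detour over a common denominator. *)
Lemma max_ratio (T : finType) (D : {pred T}) (p q : T -> nat) x0 :
    x0 \in D -> {in D, forall x, 0 < q x} ->
  exists2 x, x \in D & {in D, forall y, p y * q x <= p x * q y}.
Proof.
(* M! is a common denominator, so that integer quotients compare exactly *)
move=> x0D q_gt0; pose M := \max_(x : T) q x.
have qM x : x \in D -> q x %| M`!.
  by move=> xD; rewrite dvdn_fact // q_gt0 //= leq_bigmax.
have [x xD xmax] := @arg_maxnP T x0 D (fun x => p x * (M`! %/ q x)) x0D.
exists x => // y yD; have le : p y * (M`! %/ q y) <= p x * (M`! %/ q x) := xmax y yD.
have Mpos := fact_gt0 M; rewrite -(leq_pmul2r Mpos).
have -> : p y * q x * M`! = p y * (M`! %/ q y) * (q x * q y).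
  by rewrite -{1}(divnK (qM y yD)); lia.
have -> : p x * q y * M`! = p x * (M`! %/ q x) * (q x * q y).
  by rewrite -{1}(divnK (qM x xD)); lia.
by rewrite leq_mul2r le orbT.
Qed.

Section Families.
Variables (V E : finType) (G : mgraph V E).
Implicit Types (P Q X : {set V}) (F R : {set {set V}}).

Definition branch_family F : bool :=
  trivIset F && [forall P in F, connset (adj G) P && (P \subset vset G)].

Definition touch P Q := (P != Q) && nb (adj G) P Q.

Lemma touch_sym : symmetric touch.
Proof. by move=> P Q; rewrite /touch [P == Q]eq_sym (nb_sym (@adj_sym _ _ G)). Qed.

Lemma touch_irr : irreflexive touch.
Proof. by move=> P; rewrite /touch eqxx. Qed.

Lemma branch_familyP F : reflect
  [/\ {in F &, forall P Q v, v \in P -> v \in Q -> P = Q},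
      {in F, forall P, connset (adj G) P} & {in F, forall P, P \subset vset G}]
  (branch_family F).
Proof.
apply: (iffP andP) => [[/trivIsetP Fd /forall_inP FG]|[Fd Fc FG]].
  split=> [P Q PF QF v vP vQ|P /FG/andP[]//|P /FG/andP[]//].
  by apply/eqP; apply: contraTT vQ => /(Fd P Q PF QF)/disjointFr ->.
split; last by apply/forall_inP=> P PF; rewrite Fc ?FG.
apply/trivIsetP=> P Q PF QF; apply: contraNT => /pred0Pn[v /andP[vP vQ]].
by apply/eqP; apply: Fd vP vQ.
Qed.

Lemma branch_family_sub F R : R \subset F -> branch_family F -> branch_family R.
Proof.
move=> /subsetP RF /branch_familyP[Fd Fc FG]; apply/branch_familyP; split.
- by move=> P Q /RF PF /RF QF; apply: Fd.
- by move=> P /RF; apply: Fc.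
- by move=> P /RF; apply: FG.
Qed.

(** Merging two adjacent members loses the edge between them and, for every
    common neighbour, one of two edges that become parallel.  As [degsum] counts
    every edge twice, both losses are doubled. *)
Lemma branch_family_merge F P Q : branch_family F -> P \in F -> Q \in F -> touch P Q ->
  exists2 F', branch_family F' & #|F'|.+1 = #|F| /\
    degsum touch F = degsum touch F' + 2 * #|nbrs touch F P :&: nbrs touch F Q| + 2.
Proof.
move=> Ff PF QF /andP[PQ nPQ]; have /branch_familyP[Fd Fc FG] := Ff.
pose R := F :\ P :\ Q; have RF : R \subset F by rewrite /R; do 2!apply: subset_trans (subD1set _ _) _.
have RP X : X \in R -> [/\ X != P, X != Q & X \in F].
  by rewrite !inE => /and3P[].
have FE : F = P |: (Q |: R) by rewrite /R setD1K ?setD1K // !inE eq_sym PQ.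
have PR : P \notin Q |: R by rewrite !inE eqxx andbF orbF.
have QR : Q \notin R by rewrite !inE eqxx.
have far X : X \in R -> X != P :|: Q.
  case/RP=> XP XQ XF; apply: contraNneq XP => XE.
  have /set0Pn[v vP] := connset_neq0 (Fc P PF).
  by apply/eqP; apply: (Fd X P XF PF v) => //; rewrite XE inE vP.
have PQR : P :|: Q \notin R by apply/negP=> /far; rewrite eqxx.
exists (P :|: Q |: R).
  apply/branch_familyP; split.
  - have dis X v : X \in R -> v \in X -> v \notin P :|: Q.
      case/RP=> XP XQ XF vX; apply/negP=> /setUP[vP|vQ].
        by case/eqP: XP; apply: Fd vX vP.
      by case/eqP: XQ; apply: Fd vX vQ.
    move=> X Y /setU1P[->|XR] /setU1P[->|YR] v vX vY //.
    + by have := dis Y v YR vY; rewrite vX.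
    + by have := dis X v XR vX; rewrite vY.
    + by apply: Fd vX vY; apply: (subsetP RF).
  - move=> X /setU1P[->|/(subsetP RF)/Fc //].
    by apply: connsetU (Fc P PF) (Fc Q QF) nPQ; exact: adj_sym.
  - by move=> X /setU1P[->|/(subsetP RF)/FG //]; rewrite subUset !FG.
split; first by rewrite {1}FE !cardsU1 PR QR PQR.
rewrite {1}FE !degsumU1 //; try exact: touch_sym; try exact: touch_irr.
have -> : nbrs touch (Q |: R) P = Q |: nbrs touch R P.
  by apply/setP=> X; rewrite !inE; case: eqP => // ->; rewrite /touch PQ nPQ.
rewrite cardsU1 inE (negPf QR) /=.
have -> : nbrs touch R (P :|: Q) = nbrs touch R P :|: nbrs touch R Q.
  apply/setP=> X; rewrite /touch !(inE, nbUl (adj G)) /= -!in_setD1.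
  rewrite -[_ \in _]/(X \in R); have [XR|//] := boolP (X \in R).
  by have [XP XQ _] := RP X XR; rewrite !(eq_sym _ X) (far X XR) XP XQ.
have -> : nbrs touch F P :&: nbrs touch F Q = nbrs touch R P :&: nbrs touch R Q.
  apply/setP=> X; rewrite !inE; case: (eqVneq X P) => [->|XP]; first by rewrite touch_irr ?eqxx !andbF.
  by case: (eqVneq X Q) => [->|XQ] //=; rewrite touch_irr !andbF.
have := cardsUI (nbrs touch R P) (nbrs touch R Q).
move: #|nbrs touch R P :|: nbrs touch R Q| #|nbrs touch R P :&: nbrs touch R Q|.
by move: #|nbrs touch R P| #|nbrs touch R Q| (degsum touch R) => *; lia.
Qed.

(** A branch set consists of one of k members that have many common
    neighbours in pairs, and of the common neighbours chosen for the pairs in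
    which it comes first. *)
Lemma clique_of_close S k :
    branch_family S -> eset G != set0 ->
    {in S, forall P, #|S| <= 2 * #|nbrs touch S P| + 2} ->
    6 * (k * k + k + 2) <= #|S| ->
  minor (clique k) G.
Proof.
move=> Sf E0 Sdeg Sk; have /branch_familyP[Sd Sc SG] := Sf.
have [K KS [Kk Kc]] := close_clique Sdeg Sk.
pose x (i : 'I_k) := enum_val (cast_ord (esym Kk) i).
have xK i : x i \in K by exact: enum_valP.
have xS i : x i \in S by exact: (subsetP KS).
have xinj : injective x by move=> i j /enum_val_inj/cast_ord_inj.
pose A (p : 'I_k * 'I_k) := (nbrs touch S (x p.1) :&: nbrs touch S (x p.2)) :\: K.
pose s := enum [set p : 'I_k * 'I_k | p.1 < p.2].
have [|m [minj mA]] := @distinct_representatives _ _ set0 A s (enum_uniq _).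
  move=> p; rewrite mem_enum inE => pp.
  apply: leq_trans (Kc _ _ (xK p.1) (xK p.2) _); last first.
    by apply: contraTneq pp => /xinj ->; rewrite ltnn.
  rewrite -cardE; apply: leq_trans (max_card _) _.
  by rewrite card_prod card_ord.
have ms (i j : 'I_k) : i < j -> (i, j) \in s by move=> ij; rewrite mem_enum inE.
have mP (i j : 'I_k) : i < j -> [/\ m (i, j) \in S, m (i, j) \notin K,
                           touch (x i) (m (i, j)) & touch (x j) (m (i, j))].
  by move=> /ms/mA; rewrite !inE => /and3P[-> /andP[-> ->] /andP[_ ->]].
pose M i := x i |: [set m (i, j) | j : 'I_k in [pred j : 'I_k | i < j]].
have MS i : M i \subset S.
  by apply/subsetP=> P /setU1P[->//|/imsetP[j ij ->]]; have [] := mP i j ij.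
have Md i j P : P \in M i -> P \in M j -> i = j.
  case/setU1P=> [->|/imsetP[i' ii' ->]] /setU1P[|/imsetP[j' jj' ]].
  - exact: xinj.
  - by move=> xE; have [_] := mP j j' jj'; rewrite -xE xK.
  - by move=> xE; have [_] := mP i i' ii'; rewrite xE xK.
  - by move=> mE; case: (minj _ _ (ms _ _ ii') (ms _ _ jj') mE).
apply: (@clique_minor _ _ _ _ (fun i => cover (M i))) => //.
- move=> i; apply/subsetP=> v /bigcupP[P PM vP].
  by apply: (subsetP (SG P _)) vP; apply: (subsetP (MS i)).
- move=> i; apply: (connset_hook (@adj_sym _ _ G) (Sc (x i) (xS i))).
    by apply/subsetP=> w wx; apply/bigcupP; exists (x i); rewrite ?setU11.
  move=> w /bigcupP[P PM wP]; exists P; split=> //.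
  + by apply: Sc; apply: (subsetP (MS i)).
  + by apply/subsetP=> v vP; apply/bigcupP; exists P.
  case/setU1P: PM => [PE|/imsetP[j ij PE]].
    by left; exists w; rewrite -?PE.
  by right; rewrite PE; have [_ _ /andP[]] := mP i j ij.
- move=> i j v /bigcupP[P PM vP] /bigcupP[Q QM vQ].
  apply: (Md i j P) => //; rewrite (Sd P Q _ _ v vP vQ) //.
    exact: (subsetP (MS i)).
  exact: (subsetP (MS j)).
- have half (i j : 'I_k) : i < j -> nb (adj G) (cover (M i)) (cover (M j)).
    move=> ij; have [_ _ _ /andP[_ /nbP[u [w [ux wm uw]]]]] := mP i j ij.
    apply/nbP; exists w, u; split; last by rewrite adj_sym.
      by apply/bigcupP; exists (m (i, j)) => //; rewrite setU1r //; apply/imsetP; exists j.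
    by apply/bigcupP; exists (x j); rewrite ?setU11.
  move=> i j; rewrite neq_ltn => /orP[/half//|/half].
  by rewrite (nb_sym (@adj_sym _ _ G)).
Qed.

(** Take a family that maximises the ratio of edges to members.  Merging the
    ends of an edge does not raise the ratio, so they have many common
    neighbours.  Removing a member P of least degree does not raise it either,
    so P has degree at least d / 2.  As that degree is at most twice the ratio,
    within the neighbourhood of P every member is adjacent to about half of the
    others. *)
Lemma clique_of_family F0 d k :
    branch_family F0 -> F0 != set0 -> eset G != set0 ->
    {in F0, forall P, d <= #|nbrs touch F0 P|} -> 12 * (k * k + k + 2) <= d ->
  minor (clique k) G.
Proof.
move=> F0f F00 E0 F0d kd.
pose D := [pred F | branch_family F && (F != set0)].
have [||F /andP[Ff Fn0] Fmax] := @max_ratio _ D (degsum touch) (fun F => #|F|) F0.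
- by rewrite inE F0f.
- by move=> F /andP[_]; rewrite card_gt0.
have Fgt0 : 0 < #|F| by rewrite card_gt0.
have Fmax' F' : branch_family F' -> #|F'|.+1 = #|F| -> degsum touch F' * #|F| <= degsum touch F * #|F'|.
  move=> F'f F'F; have [F'0|F'0] := eqVneq F' set0.
    by rewrite F'0 /degsum big_set0.
  by apply: Fmax; rewrite inE F'f.
have dF : d * #|F| <= degsum touch F.
  have := Fmax F0; rewrite inE F0f F00 => /(_ isT) le0.
  have : #|F0| * d <= degsum touch F0.
    by rewrite -sum_nat_const; apply: leq_sum => P /F0d.
  have F0gt0 : 0 < #|F0| by rewrite card_gt0.
  move: le0; move: (degsum touch F0) (degsum touch F) #|F0| F0gt0 #|F| => a b p p0 q le0 le1.
  by rewrite -(leq_pmul2r p0); apply: leq_trans le0; nia.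
have [P PF Pmin] : exists2 P, P \in F & #|nbrs touch F P| * #|F| <= degsum touch F.
  have [P0 P0F] := set0Pn _ Fn0.
  have [P PF Pmin] := @arg_minnP _ P0 (mem F) (fun P => #|nbrs touch F P|) P0F.
  exists P => //; rewrite mulnC -sum_nat_const; apply: leq_sum => Q QF; exact: Pmin.
have common Q X : Q \in F -> X \in F -> touch Q X ->
    degsum touch F <= (2 * #|nbrs touch F Q :&: nbrs touch F X| + 2) * #|F|.
  move=> QF XF QX; have [F' F'f [F'F dE]] := branch_family_merge Ff QF XF QX.
  have := Fmax' F' F'f F'F; rewrite -F'F {1 2}dE.
  move: (degsum touch F) (degsum touch F') #|F'| (#|_ :&: _|) => a b p q; nia.
have Pdeg : degsum touch F <= 2 * #|nbrs touch F P| * #|F|.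
  have PF' : #|F :\ P|.+1 = #|F| by rewrite [in RHS](cardsD1 P) PF.
  have := Fmax' _ (branch_family_sub (subD1set F P) Ff) PF'.
  have := degsumU1 touch_sym touch_irr (negbT (setD11 P F)); rewrite setD1K // => dE.
  have -> : nbrs touch F P = nbrs touch (F :\ P) P.
    by apply/setP=> X; rewrite !inE; case: eqP => // ->; rewrite touch_irr !andbF.
  rewrite -PF' dE.
  move: (degsum touch (F :\ P)) #|F :\ P| #|nbrs touch (F :\ P) P| => a p q; nia.
apply: (@clique_of_close (nbrs touch F P)) => //.
- by apply: branch_family_sub Ff; apply/subsetP=> X; rewrite inE => /andP[].
- move=> Q; rewrite inE => /andP[QF PQ].
  have -> : nbrs touch (nbrs touch F P) Q = nbrs touch F P :&: nbrs touch F Q.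
    by apply/setP=> X; rewrite !inE; case: (X \in F); rewrite //= andbC.
  have := common P Q PF QF PQ; move: Pmin.
  move: #|nbrs touch F P| #|nbrs touch F P :&: _| (degsum touch F) => a b e; nia.
- move: kd dF Pdeg; move: #|nbrs touch F P| #|F| Fgt0 (degsum touch F) => a b b0 e; nia.
Qed.

End Families.

(** * Separations and growth of connected sets *)

Section Loose.
Variables (V E : finType) (G : mgraph V E) (alpha beta : nat).
Implicit Types (P Q S U W A : {set V}).
Hypothesis loose : loosely_connected alpha beta G.

Lemma loose_sep P Q : P \subset vset G -> Q \subset vset G -> [disjoint P & Q] ->
    ~~ nb (adj G) P Q -> #|vset G :\: (P :|: Q)| < beta ->
  #|P| <= alpha \/ #|Q| <= alpha.
Proof.
move=> PG QG PQ nPQ cut.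
have DP : (vset G :\: Q) :\: (vset G :\: P) = P.
  apply/setP=> v; rewrite !inE; case: (boolP (v \in P)) => [vP|vP].
    by rewrite (disjointFr PQ vP) (subsetP PG).
  by case: (v \in vset G); rewrite ?andbF.
have DQ : (vset G :\: P) :\: (vset G :\: Q) = Q.
  apply/setP=> v; rewrite !inE; case: (boolP (v \in Q)) => [vQ|vQ].
    by rewrite (disjointFl PQ vQ) (subsetP QG).
  by case: (v \in vset G); rewrite ?andbF.
have := @loose (vset G :\: Q) (vset G :\: P).
rewrite DP DQ -setDUr geq_min => /(_ _ _ _)/orP; apply.
- by rewrite -setDIr disjoint_setI0 ?setD0 // disjoint_sym.
- by move=> x y xP yQ; apply: contra nPQ => xy; apply/nbP; exists x, y.
- by rewrite setUC.
Qed.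

(** Removing the outer ends of the edges that leave S turns an edge cut into a
    vertex separation of no larger order. *)
Lemma loose_cut S : S \subset vset G -> #|between G S (vset G :\: S)| < beta ->
  #|S| <= alpha \/ #|vset G :\: S| <= alpha + #|between G S (vset G :\: S)|.
Proof.
move=> SG; set B := between _ _ _ => cut.
have dis : [disjoint S & vset G :\: S] by exact: disjointDr.
pose N := [set w in vset G :\: S | [exists u in S, adj G u w]].
have NB : #|N| <= #|B|.
  have [S0|[s _]] := set_0Vmem N; first by rewrite S0 cards0.
  pose f a := odflt s [pick w in ends G a :&: (vset G :\: S)].
  apply: leq_trans (leq_imset_card f B); apply: subset_leq_card.
  apply/subsetP=> w; rewrite inE => /andP[wS /exists_inP[u uS /adjP[a aG aE]]].
  apply/imsetP; exists a; first by apply/betweenP => //; exists u, w.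
  rewrite /f; case: pickP => [w' /=|/(_ w)]; rewrite aE !inE; last first.
    by move: wS; rewrite !inE eqxx orbT => ->.
  by case/andP=> /orP[]/eqP-> => [|//]; rewrite uS.
have : #|S| <= alpha \/ #|vset G :\: S :\: N| <= alpha.
  apply: loose_sep => //.
  - exact: subset_trans (subsetDl _ _) (subsetDl _ _).
  - exact: disjointWr (subsetDl _ _) dis.
  - apply/negP=> /nbP[u [w [uS]]]; rewrite inE => /andP[+ wS] uw.
    by rewrite inE wS negb_and /= => /exists_inPn/(_ u uS); rewrite uw.
  - apply: leq_ltn_trans cut; apply: leq_trans NB; apply: subset_leq_card.
    apply/subsetP=> v; rewrite !inE; case: (v \in S) => //=.
    by case: (v \in vset G); rewrite ?andbF //= !andbT negbK.
case=> [le|le]; [by left | right].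
have := cardsID N (vset G :\: S).
have := subset_leq_card (subsetIr (vset G :\: S) N); lia.
Qed.

End Loose.

Section Grow.
Variables (V : finType) (e : rel V) (W : {set V}) (piece : V -> {set V}) (m : nat).
Implicit Types (P Q U A : {set V}).
Hypothesis esym : symmetric e.
Hypothesis piece_mem : forall y, y \in W -> y \in piece y.
Hypothesis piece_sub : forall y, y \in W -> piece y \subset W.
Hypothesis piece_conn : forall y, y \in W -> connset e (piece y).
Hypothesis piece_card : forall y, y \in W -> #|piece y| <= m.
Hypothesis piece_eq : forall x y, y \in W -> x \in piece y -> piece x = piece y.
Hypothesis no_split : forall P Q, P :|: Q = W -> [disjoint P & Q] -> ~~ nb e P Q ->
  #|P| <= m \/ #|Q| <= m.

(** Add adjacent pieces to the piece of y as long as the size is at most m;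
    either the next piece exceeds m, or nothing in W is adjacent any more. *)
Lemma grow_piece y : y \in W ->
  (exists A, [/\ A \subset W, connset e A, forall x, x \in A -> piece x \subset A
                & m < #|A| <= 2 * m]) \/
  (exists A, [/\ A \subset W, y \in A, #|A| <= m & ~~ nb e A (W :\: A)]).
Proof.
move=> yW.
pose good A := [&& A \subset W, y \in A, connset e A, #|A| <= m &
                  [forall x in A, piece x \subset A]].
have gy : good (piece y).
  rewrite /good piece_sub // piece_mem // piece_conn // piece_card //=.
  by apply/forall_inP=> x /(piece_eq yW) ->.
have [A /and5P[AW yA Ac Am /forall_inP Ap] Amax] := @arg_maxnP _ (piece y) good (fun A => #|A|) gy.
have [/nbP[u [w [uA wA uw]]]|nA] := boolP (nb e A (W :\: A)); last first.
  by right; exists A.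
have /setDP[wW wA'] := wA.
have wAp : w \in A :|: piece w by rewrite inE piece_mem ?orbT.
left; exists (A :|: piece w); split.
- by rewrite subUset AW piece_sub.
- by apply: connsetU => //; [exact: piece_conn | apply/nbP; exists u, w; rewrite piece_mem].
- move=> x /setUP[/Ap xA|/(piece_eq wW) ->]; last exact: subsetUr.
  exact: subset_trans xA (subsetUl _ _).
apply/andP; split; last first.
  by rewrite mul2n -addnn (leq_trans (leq_card_setU _ _).1) // leq_add // piece_card.
rewrite ltnNge; apply/negP=> le.
have : good (A :|: piece w).
  rewrite /good le subUset AW piece_sub // inE yA /=; apply/andP; split.
    by apply: connsetU => //; [exact: piece_conn | apply/nbP; exists u, w; rewrite piece_mem].
  apply/forall_inP=> x /setUP[/Ap xA|/(piece_eq wW) ->]; last exact: subsetUr.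
  exact: subset_trans xA (subsetUl _ _).
move/Amax; rewrite /= leqNgt => /negP; apply; apply: proper_card; apply/properP.
by split; [exact: subsetUl | exists w].
Qed.

(** If every component of W had at most m vertices, a union of components
    would split W into two nonadjacent parts larger than m. *)
Lemma grow : 3 * m < #|W| ->
  exists A, [/\ A \subset W, connset e A, forall x, x \in A -> piece x \subset A
                & m < #|A| <= 2 * m].
Proof.
move=> Wm.
pose closed U := [&& U \subset W, #|U| <= m & ~~ nb e U (W :\: U)].
have c0 : closed set0.
  rewrite /closed sub0set cards0 /=; apply/negP=> /nbP[u [w []]]; by rewrite inE.
have [U /and3P[UW Um Uc] Umax] := @arg_maxnP _ set0 closed (fun U => #|U|) c0.
have [y yW yU] : exists2 y, y \in W & y \notin U.
  by apply/subsetPn; apply/negP=> /subset_leq_card; lia.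
have [//|[A [AW yA Am Ac]]] := grow_piece yW.
(* U + A exceeds m by maximality of U, and so does the rest, as |W| > 3 m *)
have nUA : ~~ nb e (U :|: A) (W :\: (U :|: A)).
  rewrite nbUl negb_or; apply/andP; split.
    apply: contra Uc => /nbP[u [w [uU]]]; rewrite !inE negb_or => /andP[/andP[wU _] wW] uw.
    by apply/nbP; exists u, w; rewrite inE wU.
  apply: contra Ac => /nbP[u [w [uU]]]; rewrite !inE negb_or => /andP[/andP[_ wU] wW] uw.
  by apply/nbP; exists u, w; rewrite inE wU.
have UAW : U :|: A \subset W by rewrite subUset UW.
have lt : #|U| < #|U :|: A|.
  apply: proper_card; apply/properP; split; first exact: subsetUl.
  by exists y; rewrite // inE yA orbT.
have := (leq_card_setU U A).1; have := cardsD W (U :|: A); rewrite (setIidPr UAW) => cD cU.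
have [||le|] := no_split _ _ nUA.
- by rewrite -{1}(setIidPr UAW) setID.
- exact: disjointDr.
- by have /Umax : closed (U :|: A) by [rewrite /closed UAW le]; lia.
- lia.
Qed.

End Grow.

(** * Balls and breadth-first forests *)

Section Ball.
Variables (V E : finType) (G : mgraph V E).
Implicit Types (P Q S Y : {set V}).

Definition thicken S : {set V} := S :|: [set w | [exists u in S, adj G u w]].
Definition ball k S : {set V} := iter k thicken S.

Lemma ballS k Y : ball k.+1 Y = thicken (ball k Y). Proof. by []. Qed.

Lemma thickenS S S' : S \subset S' -> thicken S \subset thicken S'.
Proof.
move=> SS'; apply: setUSS => //; apply/subsetP=> w; rewrite !inE.
by case/exists_inP=> u uS uw; apply/exists_inP; exists u; rewrite // (subsetP SS').
Qed.

Lemma ballSS k Y Y' : Y \subset Y' -> ball k Y \subset ball k Y'.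
Proof. by move=> YY'; elim: k => //= k; exact: thickenS. Qed.

Lemma ball_step k Y u w : u \in ball k Y -> adj G u w -> w \in ball k.+1 Y.
Proof. by move=> uY uw; rewrite !inE; apply/orP; right; apply/exists_inP; exists u. Qed.

Lemma ball_mono j k Y : j <= k -> ball j Y \subset ball k Y.
Proof.
move/subnK <-; elim: (k - j) => [|i IH] //=.
exact: subset_trans IH (subsetUl _ _).
Qed.

Lemma ball_trans j k x y w : y \in ball j [set x] -> w \in ball k [set y] ->
  w \in ball (j + k) [set x].
Proof.
rewrite addnC /ball iterD -/(ball j _) -!/(ball k _) => yx.
by apply/subsetP/ballSS; rewrite sub1set.
Qed.

Lemma ball_sym k x y : (y \in ball k [set x]) = (x \in ball k [set y]).
Proof.
suff H u w : u \in ball k [set w] -> w \in ball k [set u] by apply/idP/idP; exact: H.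
elim: k u w => [|k IH] u w; first by rewrite !inE eq_sym.
rewrite ballS => /setUP[uk|].
  by apply: (subsetP (ball_mono _ (leqnSn k))); exact: IH.
rewrite inE => /exists_inP[v /IH wv vu]; rewrite -add1n; apply: ball_trans wv.
by apply: (@ball_step 0 _ u); rewrite ?set11 // adj_sym.
Qed.

(** A ball that is not yet everything grows strictly with its radius, which
    bounds the radius needed to reach all vertices. *)
Lemma ball_exhaust k Y : connset (adj G) (vset G) -> Y \subset vset G -> Y != set0 ->
  ~~ (vset G \subset ball k Y) -> k < #|ball k Y|.
Proof.
move=> Gc YG Y0; elim: k => [|k IH] nG; first by rewrite card_gt0.
have nG' : ~~ (vset G \subset ball k Y).
  apply: contra nG => /subset_trans; apply; exact: ball_mono.
apply: leq_ltn_trans (IH nG') _; apply: proper_card.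
have [w wG wk] := subsetPn nG'; have [y yY] := set0Pn _ Y0.
have [|u [v [uG uk vG vk uv]]] := connset_cross Gc (subsetP YG y yY) _ wG wk.
  exact: (subsetP (ball_mono Y (leq0n k))).
apply/properP; split; first exact: ball_mono.
by exists v => //; exact: ball_step uk uv.
Qed.

Lemma ball_full Y : connset (adj G) (vset G) -> Y \subset vset G -> Y != set0 ->
  vset G \subset ball #|V| Y.
Proof.
move=> Gc YG Y0; apply: contraT => /(ball_exhaust Gc YG Y0).
by rewrite ltnNge max_card.
Qed.

(** The height of a vertex is its distance to the root set.  Making the roots
    their own parents keeps the iterates of [par] total. *)
Record forest Y (h : V -> nat) (par : V -> V) : Prop := Forest {
  height_ball : forall v k, v \in vset G -> (v \in ball k Y) = (h v <= k);
  par_root : forall v, v \in Y -> par v = v;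
  par_adj : forall v, v \in vset G -> v \notin Y -> adj G v (par v);
  par_height : forall v, v \in vset G -> v \notin Y -> h v = (h (par v)).+1
}.

Lemma forest_exists Y : connset (adj G) (vset G) -> Y \subset vset G -> Y != set0 ->
  exists h par, forest Y h par.
Proof.
move=> Gc YG Y0.
have /fin_all_exists[h hP] v : exists n, v \in vset G -> forall k, (v \in ball k Y) = (n <= k).
  have [vG|_] := boolP (v \in vset G); last by exists 0.
  have vex : exists n, v \in ball n Y by exists #|V|; apply: (subsetP (ball_full Gc YG Y0)).
  exists (ex_minn vex) => _ k; case: ex_minnP => n vn nmin; apply/idP/idP=> [/nmin//|nk].
  exact: (subsetP (ball_mono Y nk)).
have /fin_all_exists[par parP] v : exists u, (v \in Y -> u = v) /\
    (v \in vset G -> v \notin Y -> adj G v u /\ h v = (h u).+1).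
  have [vY|vY] := boolP (v \in Y); first by exists v.
  have [vG|_] := boolP (v \in vset G); last by exists v.
  have : v \in ball (h v) Y by rewrite hP.
  case: (h v) (hP v vG) => [|n] hv; first by rewrite (negPf vY).
  rewrite ballS => /setUP[|]; first by rewrite hv ltnn.
  rewrite inE => /exists_inP[u un uv]; exists u; split=> // _ _; split; first by rewrite adj_sym.
  have uG := (adj_vset uv).1; congr _.+1; apply/eqP; rewrite eqn_leq -(hP u uG) un andbT.
  have : v \in ball (h u).+1 Y by apply: ball_step uv; rewrite hP.
  by rewrite hv.
exists h, par; split.
- by move=> v k vG; exact: hP.
- by move=> v /(parP v).1.
- by move=> v vG vY; have [] := (parP v).2 vG vY.
- by move=> v vG vY; have [] := (parP v).2 vG vY.
Qed.

Section Forest.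
Variables (Y : {set V}) (h : V -> nat) (par : V -> V).
Hypothesis Fo : forest Y h par.

Lemma root_height v : v \in vset G -> (v \in Y) = (h v == 0).
Proof. by move=> vG; rewrite -leqn0 -(height_ball Fo). Qed.

Lemma adj_height u w : adj G u w -> h w <= (h u).+1.
Proof.
move=> uw; have [uG wG] := adj_vset uw.
by rewrite -(height_ball Fo) //; apply: ball_step uw; rewrite (height_ball Fo).
Qed.

Lemma par_vset v : v \in vset G -> par v \in vset G.
Proof.
move=> vG; have [vY|vY] := boolP (v \in Y); first by rewrite (par_root Fo).
by have /adj_vset[] := par_adj Fo vG vY.
Qed.

Lemma anc_vset k v : v \in vset G -> iter k par v \in vset G.
Proof. by move=> vG; elim: k => //= k; exact: par_vset. Qed.

Lemma height_par v : v \in vset G -> h (par v) = (h v).-1.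
Proof.
move=> vG; have [vY|vY] := boolP (v \in Y); last by rewrite (par_height Fo vG vY).
by have := vY; rewrite (par_root Fo) // (root_height vG) => /eqP ->.
Qed.

Lemma height_anc k v : v \in vset G -> h (iter k par v) = h v - k.
Proof.
move=> vG; elim: k => [|k IH]; first by rewrite subn0.
by rewrite iterS height_par ?anc_vset // IH subnS.
Qed.

Definition desc v : {set V} :=
  [set u in vset G | (h v <= h u) && (iter (h u - h v) par u == v)].

Lemma desc_vset v : desc v \subset vset G.
Proof. by apply/subsetP=> u; rewrite inE => /andP[]. Qed.

Lemma desc_refl v : v \in vset G -> v \in desc v.
Proof. by move=> vG; rewrite inE vG leqnn subnn /= eqxx. Qed.

Lemma desc_height u v : u \in desc v -> h v <= h u.
Proof. by rewrite inE => /and3P[]. Qed.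

Lemma desc_par u v : u \in desc v -> u != v -> u \notin Y /\ par u \in desc v.
Proof.
rewrite inE => /and3P[uG le /eqP anc] uv.
have lt : h v < h u.
  by rewrite ltn_neqAle le andbT; apply: contraNneq uv => hE; rewrite -anc hE subnn.
split; first by rewrite (root_height uG) -lt0n (leq_ltn_trans _ lt).
rewrite inE par_vset // height_par //=; apply/andP; split; first by lia.
have -> : (h u).-1 - h v = (h u - h v).-1 by lia.
by rewrite -iterSr prednK ?subn_gt0 // anc.
Qed.

Lemma par_desc u v : u \in vset G -> par u \in desc v -> u \in desc v.
Proof.
move=> uG; have [uY|uY] := boolP (u \in Y); first by rewrite (par_root Fo).
rewrite !inE uG (par_height Fo uG uY) => /and3P[_ le anc].
by rewrite leqW //= subSn // iterSr.
Qed.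

Lemma desc_anc k v : v \in vset G -> k <= h v -> v \in desc (iter k par v).
Proof.
by move=> vG kv; rewrite inE vG height_anc // leq_subr /= subKn.
Qed.

Lemma descP u v : u \in desc v -> v = iter (h u - h v) par u.
Proof. by rewrite inE => /and3P[_ _ /eqP]. Qed.

Lemma desc_trans u v w : u \in desc v -> v \in desc w -> u \in desc w.
Proof.
rewrite !inE => /and3P[uG vu /eqP vE] /and3P[vG wv /eqP wE].
rewrite uG (leq_trans wv vu) /= -{2}wE -{2}vE -iterD; apply/eqP; congr (iter _ _ _); lia.
Qed.

Lemma desc_sub u v : u \in desc v -> desc u \subset desc v.
Proof. by move=> uv; apply/subsetP=> w wu; exact: desc_trans wu uv. Qed.

Lemma desc_eq u v w : h u = h v -> w \in desc u -> w \in desc v -> u = v.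
Proof. by move=> huv /descP-> /descP ->; rewrite huv. Qed.

(** Both u and v are iterated parents of w. *)
Lemma desc_comparable u v w : v \in vset G -> h v <= h u -> w \in desc u -> w \in desc v -> u \in desc v.
Proof.
move=> vG le wu wv; have wG := subsetP (desc_vset u) w wu.
have lu := desc_height wu; have lv := desc_height wv.
have -> : v = iter (h u - h v) par u.
  rewrite (congr1 (iter (h u - h v) par) (descP wu)) -iterD {1}(descP wv).
  by congr (iter _ _ _); lia.
by apply: desc_anc; [rewrite (descP wu) anc_vset | lia].
Qed.

(** Following parents from a vertex beyond a cut leads, through decreasing
    heights, into the side that contains the core. *)
Lemma connset_hang C P : P \subset vset G -> connset (adj G) C -> C \subset P ->
    (forall v, v \in P -> v \notin C -> v \notin Y /\ par v \in P) ->
  connset (adj G) P.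
Proof.
move=> PG Cc /subsetP CP hang; have [c cC] := set0Pn _ (connset_neq0 Cc).
apply: (connset_intro (@adj_sym _ _ G) (CP c cC)) => U w0 cU w0P w0U.
have [/subsetP CU|/subsetPn[c' c'C c'U]] := boolP (C \subset U); last first.
  have [u [w [uC uU wC wU uw]]] := connset_cross Cc cC cU c'C c'U.
  by exists u, w; rewrite !CP.
elim: {w0}(h w0) {-2}w0 (erefl (h w0)) w0P w0U => [|n IH] w hw wP wU.
  have [|wY _] := hang w wP; first by apply: contra wU => /CU.
  by move: wY; rewrite root_height ?hw // (subsetP PG).
have [|wY pP] := hang w wP; first by apply: contra wU => /CU.
have wG := subsetP PG w wP.
have [pU|pU] := boolP (par w \in U); last first.
  by apply: (IH (par w)) => //; rewrite height_par // hw.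
by exists (par w), w; split=> //; rewrite adj_sym (par_adj Fo).
Qed.

Lemma connset_top t P : P \subset vset G -> t \in P ->
    (forall v, v \in P -> v != t -> v \notin Y /\ par v \in P) ->
  connset (adj G) P.
Proof.
move=> PG tP hang; apply: (@connset_hang [set t]); rewrite ?sub1set //.
  by apply: connset1; exact: adj_sym.
by move=> v vP; rewrite inE; exact: hang.
Qed.

Lemma desc_conn v : v \in vset G -> connset (adj G) (desc v).
Proof.
move=> vG; apply: (@connset_top v); first exact: desc_vset.
  exact: desc_refl.
by move=> u; exact: desc_par.
Qed.

(** Collect all ancestors of the given vertices: at most r on each of the
    heights up to H, and at most b in total above height H. *)
Lemma reach_top r H b t P : P \subset vset G -> t \in P ->
    (forall v, v \in P -> v != t -> v \notin Y /\ par v \in P) ->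
    #|vset G :\: ball H Y| <= b ->
  reach G r (r * H.+1 + b + 1) P.
Proof.
move=> PG tP hang deep W WP Wr.
pose P' := t |: [set u in P | [exists w in W, w \in desc u]].
have sub : P' \subset P by rewrite subUset sub1set tP; apply/subsetP=> u; rewrite inE => /andP[].
exists P'; split=> //.
- apply/subsetP=> w wW; have wP := subsetP WP w wW.
  rewrite !inE wP; apply/orP; right; apply/exists_inP; exists w => //.
  by apply: desc_refl; apply: (subsetP PG).
- apply: (@connset_top t); rewrite ?setU11 //; first exact: subset_trans sub PG.
  move=> v /setU1P[->|]; first by rewrite eqxx.
  rewrite inE => /andP[vP /exists_inP[w wW wv]] vt.
  have [vY pP] := hang v vP vt; split=> //; rewrite !inE pP.
  apply/orP; right; apply/exists_inP; exists w => //; apply: desc_trans wv _.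
  have vG := subsetP PG v vP.
  by apply: (@desc_anc 1) => //; rewrite lt0n -root_height.
pose A := [set iter (h p.1 - p.2) par p.1 | p : V * 'I_H.+1 in setX W [set: 'I_H.+1]].
have cA : #|A| <= r * H.+1.
  apply: leq_trans (leq_imset_card _ _) _.
  by rewrite cardsX cardsT card_ord leq_mul2r Wr orbT.
have : #|P'| <= #|t |: (A :|: (vset G :\: ball H Y))|.
  apply: subset_leq_card; apply: setUS; apply/subsetP=> u.
  rewrite inE => /andP[uP /exists_inP[w wW wu]]; have uG := subsetP PG u uP.
  rewrite in_setU in_setD uG (height_ball Fo) // andbT.
  have [uH|] := leqP (h u) H; last by rewrite orbT.
  rewrite orbF; apply/imsetP; exists (w, Ordinal (uH : h u < H.+1)); first by rewrite !inE wW.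
  exact: descP wu.
have := cardsU1 t (A :|: (vset G :\: ball H Y)).
have := (leq_card_setU A (vset G :\: ball H Y)).1.
have := leq_b1 (t \notin A :|: (vset G :\: ball H Y)); lia.
Qed.

(** An edge that is not inside the root set is cut by the subtree of its higher
    end, so it is counted at a vertex outside the root set. *)
Lemma edges_off_core c : 
    (forall v, v \in vset G -> v \notin Y -> #|between G (desc v) (vset G :\: desc v)| <= c) ->
  #|[set a in eset G | ~~ (ends G a \subset Y)]| <= c * #|vset G :\: Y|.
Proof.
move=> cut.
rewrite mulnC.
apply: leq_trans (card_bigcup_le (F := fun v => between G (desc v) (vset G :\: desc v)) _).
  apply: subset_leq_card; apply/subsetP=> a; rewrite inE => /andP[aG aY].
  have /cards2P[u [w [uw aE]]] : #|ends G a| == 2 by rewrite card_ends.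
  wlog le : u w uw aE / h w <= h u.
    move=> H; have [|/ltnW] := leqP (h w) (h u); first exact: H.
    by apply: (H w u); rewrite ?aE 1?setUC // eq_sym.
  have uG : u \in vset G by apply: (ends_vset aG); rewrite aE !inE eqxx.
  have wG : w \in vset G by apply: (ends_vset aG); rewrite aE !inE eqxx orbT.
  have uY : u \notin Y.
    apply: contra aY; rewrite (root_height uG) => /eqP hu.
    rewrite aE; apply/subsetP=> v /set2P[]->; rewrite root_height ?hu //.
    by rewrite -leqn0 -hu.
  apply/bigcupP; exists u; first by rewrite inE uY.
  rewrite inE aG aE /=; apply/andP; split; apply/set0Pn.
    by exists u; rewrite in_setI desc_refl // in_set2 eqxx.
  exists w; rewrite in_setI in_set2 in_setD eqxx wG orbT andbT /=; apply/negP=> /[dup] /desc_height le' /descP uE.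
  by case/eqP: uw; rewrite uE (_ : h w - h u = 0) //; lia.
by move=> v /setDP[vG vY]; exact: cut.
Qed.

End Forest.
End Ball.

(** * Graphs with few vertices *)

Lemma leq_add_mul m n : 0 < m -> 0 < n -> m + n <= 2 * (m * n).
Proof. by nia. Qed.

Section HalfCut.
Variables (V E : finType) (G : mgraph V E).
Implicit Types (F S : {set V}).

(** An edge inside F is separated by exactly half of all vertex sets S, since
    moving one of its ends into or out of S is an involution; so some cut of F
    contains half of the edges inside F. *)
Lemma edges_le_double_cut F c :
    (forall S, S \subset F -> #|between G S (F :\: S)| <= c) ->
  #|[set a in eset G | ends G a \subset F]| <= 2 * c.
Proof.
move=> cut; set D := [set a in _ | _].
pose sep (S : {set V}) a := a \in between G (F :&: S) (F :\: (F :&: S)).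
have Mpos : 0 < #|{: {set V}}| by apply/card_gt0P; exists set0.
have half a : a \in D -> #|{: {set V}}| <= 2 * #|[set S | sep S a]|.
  rewrite inE => /andP[aG aF].
  have /cards2P[u [w [uw aE]]] : #|ends G a| == 2 by rewrite card_ends.
  have uF : u \in F by rewrite (subsetP aF) // aE !inE eqxx.
  have wF : w \in F by rewrite (subsetP aF) // aE !inE eqxx orbT.
  have sepE (S : {set V}) : sep S a = (u \in S) (+) (w \in S).
    rewrite /sep; apply/(betweenP _ _ (disjointDr _ _))/idP.
      case=> u' [w' [+ + _]]; rewrite aE !inE.
      move=> /andP[_ u'S] /andP[+ w'F]; rewrite w'F /= => w'S /setP E2.
      have := E2 u'; have := E2 w'; rewrite !inE !eqxx orbT /=.
      have u'w' : u' != w' by apply: contraTneq u'S => ->.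
      case/orP=> /eqP w'E /orP[]/eqP u'E; subst.
      + by rewrite eqxx in u'w'.
      + by rewrite u'S (negPf w'S).
      + by rewrite u'S (negPf w'S).
      + by rewrite eqxx in u'w'.
    case: (boolP (u \in S)) => uS /=.
      by move=> wS; exists u, w; split; rewrite ?inE ?uF ?wF ?uS ?wS.
    by move=> wS; exists w, u; split; rewrite 1?setUC ?inE ?uF ?wF ?uS ?wS.
  pose toggle (S : {set V}) := if u \in S then S :\ u else u |: S.
  have togK : involutive toggle.
    move=> S; rewrite /toggle; case: (boolP (u \in S)) => uS; first by rewrite setD11 setD1K.
    by rewrite setU11 setU1K.
  have togsep S : sep (toggle S) a = ~~ sep S a.
    rewrite !sepE /toggle; case: (boolP (u \in S)) => uS.
      by rewrite setD11 !inE eq_sym uw /=; case: (w \in S).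
    by rewrite setU11 !inE eq_sym (negPf uw) /=.
  have -> : #|{: {set V}}| = #|[set S | sep S a]| + #|[set S | ~~ sep S a]|.
    rewrite -(cardsC [set S | sep S a]); congr (_ + #|pred_of_set _|).
    by apply/setP=> S; rewrite !inE.
  rewrite mul2n -addnn leq_add2l -(card_imset _ (inv_inj togK)).
  apply: subset_leq_card; apply/subsetP=> S /imsetP[S'].
  by rewrite !inE => nS' ->; rewrite togsep.
rewrite -(leq_pmul2l Mpos).
apply: (@leq_trans (2 * \sum_(S : {set V}) #|between G (F :&: S) (F :\: (F :&: S))|)); last first.
  rewrite mulnCA leq_mul2l /=; apply: leq_trans (_ : \sum_(S : {set V}) c <= _).
    by apply: leq_sum => S _; apply: cut; exact: subsetIl.
  by rewrite sum_nat_const.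
apply: (@leq_trans (2 * \sum_(S : {set V}) \sum_(a in D) sep S a)); last first.
  rewrite leq_mul2l /=; apply: leq_sum => S _; rewrite big_mkcond -sum1_card [leqRHS]big_mkcond.
  by apply: leq_sum => a _; rewrite /sep; case: (a \in D) => //; case: (a \in between _ _ _).
rewrite exchange_big big_distrr /= mulnC -sum_nat_const; apply: leq_sum => a /half.
suff -> : #|[set S | sep S a]| = \sum_(S : {set V}) sep S a by [].
by rewrite -sum1_card big_mkcond; apply: eq_bigr => S _; rewrite inE; case: (sep S a).
Qed.

End HalfCut.

Section FewVertices.
Variables (V E : finType) (G : mgraph V E) (r alpha z : nat).
Implicit Types (P Q Z W A Y : {set V}).
Hypothesis Gc : connset (adj G) (vset G).
Hypothesis girth_ge : forall S : mgraph V E,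
  subgraph S G -> minor (theta r) S -> z <= #|eset S|.
Hypothesis loose : loosely_connected alpha (2 * r - 1) G.
Hypotheses (r_ge2 : 2 <= r) (alpha_gt0 : 1 <= alpha).
Hypothesis z_ge : 168 * alpha * r <= z.
Hypothesis z_le : z <= #|eset G|.

Lemma r_gt0 : 0 < r.
Proof. exact: leq_trans r_ge2. Qed.


Hypothesis n_le : #|vset G| <= 2 * (alpha + r).
Hypothesis n_ge : 168 * alpha < #|vset G|.

(** The vertices outside P and Q are at most 2r - 2, too few to separate sets
    of more than alpha vertices. *)
Lemma dense_nb P Q : P \subset vset G -> Q \subset vset G -> [disjoint P & Q] ->
  alpha < #|P| -> alpha < #|Q| -> nb (adj G) P Q.
Proof.
move=> PG QG PQ Pa Qa; apply: contraT => nPQ.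
have PQG : P :|: Q \subset vset G by rewrite subUset PG.
have := cardsD (vset G) (P :|: Q); rewrite (setIidPr PQG).
have := cardsUI P Q; rewrite (disjoint_setI0 PQ) cards0 => cU cD.
by have [||] := loose_sep loose PG QG PQ nPQ; lia.
Qed.

Lemma dense_bond P Q : P \subset vset G -> Q \subset vset G -> [disjoint P & Q] ->
  connset (adj G) P -> connset (adj G) Q -> #|between G P Q| < r.
Proof.
move=> PG QG PQ Pc Qc; apply: (few_between girth_ge) => //.
have PQG : P :|: Q \subset vset G by rewrite subUset PG.
have := subset_leq_card PQG; have := leq_add_mul alpha_gt0 r_gt0.
have := cardsUI P Q; rewrite (disjoint_setI0 PQ) cards0; lia.
Qed.

Lemma dense_block W : W \subset vset G -> 3 * alpha < #|W| ->
  exists Z, [/\ Z \subset W, connset (adj G) Z & alpha < #|Z| <= 2 * alpha].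
Proof.
move=> WG Wa; have [|||||||//|Z [ZW Zc _ Za]] := @grow V (adj G) W (fun y => [set y]) alpha.
- exact: adj_sym.
- by move=> y _; rewrite set11.
- by move=> y yW; rewrite sub1set.
- by move=> y _; apply: connset1; exact: adj_sym.
- by move=> y _; rewrite cards1.
- by move=> y w _ /set1P ->.
- move=> P Q PQW PQ nPQ.
  have [|Pa] := leqP #|P| alpha; first by left.
  have [|Qa] := leqP #|Q| alpha; first by right.
  case/negP: nPQ; apply: dense_nb => //; apply: subset_trans WG; rewrite -PQW.
    exact: subsetUl.
  exact: subsetUr.
by exists Z.
Qed.

(** Each subtree of the breadth-first forest rooted at the connected set Y has
    a connected complement, so that its cut is a bond and has fewer than r edges. *)
Lemma dense_off_core Y : Y \subset vset G -> connset (adj G) Y ->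
  #|[set a in eset G | ~~ (ends G a \subset Y)]| <= r.-1 * #|vset G :\: Y|.
Proof.
move=> YG Yc; have [h [par Fo]] := forest_exists Gc YG (connset_neq0 Yc).
apply: (edges_off_core Fo) => v vG vY; rewrite -ltnS (prednK r_gt0).
have YD : Y \subset vset G :\: desc G h par v.
  apply/subsetP=> y yY; have yG := subsetP YG y yY; rewrite inE yG andbT.
  apply: contra vY => /desc_height; rewrite (root_height Fo vG).
  by have := root_height Fo yG; rewrite yY => /esym/eqP ->; rewrite leqn0.
apply: dense_bond; rewrite ?desc_vset ?subsetDl //.
- exact: disjointDr.
- exact: (desc_conn Fo).
- apply: (connset_hang Fo _ Yc YD); first exact: subsetDl.
  move=> u /setDP[uG uv] uY; split=> //; rewrite inE (par_vset Fo) // andbT.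
  by apply: contra uv; apply: (par_desc Fo).
Qed.

(** Take disjoint connected sets Z1, Z2 of more than alpha vertices and let F
    be the vertices adjacent to both; all but 2 alpha of the remaining vertices
    are in F.  Any bipartition of F extends to connected sets that contain Z1
    and Z2, so the edges inside F are at most 2 (r - 1).  All other edges are
    off the core Z1 + F or off the core Z2 + F, which gives
    at most 4 alpha (r - 1) edges each. *)
Lemma dense_absurd : False.
Proof.
have W3 : 3 * alpha < #|vset G| by apply: leq_ltn_trans n_ge; rewrite leq_mul2r orbT.
have [Z1 [Z1G Z1c /andP[Z1a Z1a']]] := dense_block (subxx (vset G)) W3.
have [|Z2 [Z2G' Z2c /andP[Z2a Z2a']]] := @dense_block (vset G :\: Z1) (subsetDl _ _).
  rewrite cardsD (setIidPr Z1G) ltn_subRL; apply: leq_ltn_trans n_ge.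
  by apply: leq_trans (leq_add Z1a' (leqnn _)) _; rewrite -mulnDl leq_mul2r orbT.
have Z2G := subset_trans Z2G' (subsetDl _ _).
have Z12 : [disjoint Z1 & Z2].
  exact: disjointWr Z2G' (disjointDr _ _).
pose O := vset G :\: (Z1 :|: Z2).
pose F := [set v in O | nb (adj G) [set v] Z1 && nb (adj G) [set v] Z2].
have nonnb Z : Z \subset vset G -> alpha < #|Z| -> [disjoint O & Z] ->
    #|[set v in O | ~~ nb (adj G) [set v] Z]| <= alpha.
  move=> ZG Za OZ; rewrite leqNgt; apply/negP=> Na.
  have NO : [set v in O | ~~ nb (adj G) [set v] Z] \subset O by apply/subsetP=> v; rewrite inE => /andP[].
  have := dense_nb (subset_trans NO (subsetDl _ _)) ZG (disjointWl NO OZ) Na Za.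
  case/nbP=> u [w [+ wZ uw]]; rewrite inE => /andP[_ /negP]; apply.
  by apply/nbP; exists u, w; rewrite set11.
have OZ1 : [disjoint O & Z1].
  by apply: disjoint_mem => v; rewrite !inE negb_or => /andP[/andP[]].
have OZ2 : [disjoint O & Z2].
  by apply: disjoint_mem => v; rewrite !inE negb_or => /andP[/andP[]].
have FG : F \subset vset G by apply/subsetP=> v; rewrite !inE => /andP[/andP[]].
have FO : F \subset O by apply/subsetP=> v; rewrite inE => /andP[].
have hookF Z (S : {set V}) : connset (adj G) Z -> S \subset F ->
    (forall v, v \in F -> nb (adj G) [set v] Z) -> connset (adj G) (Z :|: S).
  move=> Zc SF FZ; apply: (connset_hook (@adj_sym _ _ G) Zc); first exact: subsetUl.
  move=> w /setUP[wZ|wS].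
    by exists Z; split; rewrite ?subsetUl //; left; exists w.
  exists [set w]; split; rewrite ?set11 //.
  - by apply: connset1; exact: adj_sym.
  - by rewrite sub1set inE wS orbT.
  - by right; rewrite (nb_sym (@adj_sym _ _ G)) FZ // (subsetP SF).
have FZ1 v : v \in F -> nb (adj G) [set v] Z1 by rewrite inE => /and3P[].
have FZ2 v : v \in F -> nb (adj G) [set v] Z2 by rewrite inE => /and3P[].
have eF : #|[set a in eset G | ends G a \subset F]| <= 2 * r.-1.
  apply: edges_le_double_cut => S SF; rewrite -ltnS (prednK r_gt0).
  apply: leq_ltn_trans (_ : #|between G (Z1 :|: S) (Z2 :|: (F :\: S))| < r).
    by apply: subset_leq_card; apply: betweenS; exact: subsetUr.
  apply: dense_bond.
  - by rewrite subUset Z1G (subset_trans SF).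
  - by rewrite subUset Z2G (subset_trans (subsetDl _ _)).
  - apply: disjoint_mem => v /setUP[vZ|vS]; rewrite !inE.
      rewrite (disjointFr Z12 vZ) /=; apply/negP=> /andP[_ /and3P[]].
      by rewrite vZ.
    rewrite vS /= orbF; apply/negP=> vZ.
    by have := subsetP FO v (subsetP SF v vS); rewrite !inE vZ orbT.
  - exact: hookF.
  - by apply: hookF => //; exact: subsetDl.
have Y1G : Z1 :|: F \subset vset G by rewrite subUset Z1G.
have Y2G : Z2 :|: F \subset vset G by rewrite subUset Z2G.
have e1 := dense_off_core Y1G (hookF Z1 F Z1c (subxx F) FZ1).
have e2 := dense_off_core Y2G (hookF Z2 F Z2c (subxx F) FZ2).
have cover : eset G \subset [set a in eset G | ends G a \subset F] :|:
   ([set a in eset G | ~~ (ends G a \subset Z1 :|: F)] :|: [set a in eset G | ~~ (ends G a \subset Z2 :|: F)]).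
  apply/subsetP=> a aG; rewrite !inE aG /=.
  have [/subsetP s1|] := boolP (ends G a \subset Z1 :|: F); rewrite ?orbT //=.
  have [/subsetP s2|] := boolP (ends G a \subset Z2 :|: F); rewrite ?orbT //= orbF.
  apply/subsetP=> v va; have /setUP[v1|//] := s1 v va; have /setUP[v2|//] := s2 v va.
  by rewrite (disjointFr Z12 v1) in v2.
pose N := [set v in O | ~~ nb (adj G) [set v] Z1] :|: [set v in O | ~~ nb (adj G) [set v] Z2].
have cN : #|N| <= 2 * alpha.
  apply: leq_trans (leq_card_setU _ _).1 _.
  by rewrite mul2n -addnn leq_add // nonnb.
have OFN v : v \in O -> v \notin F -> v \in N.
  move=> vO; apply: contraR => vN; rewrite inE vO /=.
  by apply/andP; split; apply: contraR vN => nZ; rewrite in_setU; apply/orP;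
    [left | right]; rewrite inE vO.
have off1 : #|vset G :\: (Z1 :|: F)| <= 4 * alpha.
  apply: leq_trans (_ : #|Z2 :|: N| <= _); last first.
    apply: leq_trans (leq_card_setU _ _).1 _.
    by rewrite (_ : 4 * alpha = 2 * alpha + 2 * alpha) ?leq_add // -mulnDl.
  apply: subset_leq_card; apply/subsetP=> v /setDP[vG]; rewrite in_setU negb_or => /andP[v1 vF]; rewrite in_setU.
  have [//|v2] := boolP (v \in Z2); apply: OFN => //.
  by rewrite in_setD in_setU vG negb_or v1 v2.
have off2 : #|vset G :\: (Z2 :|: F)| <= 4 * alpha.
  apply: leq_trans (_ : #|Z1 :|: N| <= _); last first.
    apply: leq_trans (leq_card_setU _ _).1 _.
    by rewrite (_ : 4 * alpha = 2 * alpha + 2 * alpha) ?leq_add // -mulnDl.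
  apply: subset_leq_card; apply/subsetP=> v /setDP[vG]; rewrite in_setU negb_or => /andP[v2 vF]; rewrite in_setU.
  have [//|v1] := boolP (v \in Z1); apply: OFN => //.
  by rewrite in_setD in_setU vG negb_or v1 v2.
have r_le : r.-1 <= alpha * r.-1 by rewrite leq_pmull.
have z_gt : 168 * (alpha * r.-1) < z.
  by rewrite (leq_trans _ z_ge) // -mulnA ltn_pmul2l // ltn_pmul2l // ltn_predL r_gt0.
have e_le : #|eset G| <= 2 * r.-1 + (r.-1 * (4 * alpha) + r.-1 * (4 * alpha)).
  apply: leq_trans (subset_leq_card cover) _.
  apply: leq_trans (leq_card_setU _ _).1 _; rewrite leq_add //.
  apply: leq_trans (leq_card_setU _ _).1 _; rewrite leq_add //.
    by apply: leq_trans e1 _; rewrite leq_mul2l off1 orbT.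
  by apply: leq_trans e2 _; rewrite leq_mul2l off2 orbT.
have := leq_trans z_gt (leq_trans z_le e_le); move: r_le.
by rewrite mulnCA (mulnC r.-1); clear; lia.
Qed.

End FewVertices.

(** * No vertex is close to almost all others *)

Section Far.
Variables (V E : finType) (G : mgraph V E) (r alpha z R : nat).
Implicit Types (P Q Z W A Y : {set V}).
Hypothesis Gc : connset (adj G) (vset G).
Hypothesis girth_ge : forall S : mgraph V E,
  subgraph S G -> minor (theta r) S -> z <= #|eset S|.
Hypothesis loose : loosely_connected alpha (2 * r - 1) G.
Hypotheses (r_ge2 : 2 <= r) (alpha_gt0 : 1 <= alpha).
Hypothesis z_ge : 168 * alpha * r <= z.
Hypothesis z_le : z <= #|eset G|.
Hypothesis R_le : 8 * r * R <= z.

Section Sparse.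
Variables (x : V) (h : V -> nat) (par : V -> V).
Hypothesis xG : x \in vset G.
Hypothesis Fo : forest G [set x] h par.
Let D := desc G h par.
Let s0 := r * (2 * R).+1 + 2 * (alpha + r) + 1.
Hypothesis reach_top : forall t P, P \subset vset G -> t \in P ->
    (forall v, v \in P -> v != t -> v \notin [set x] /\ par v \in P) ->
  reach G r s0 P.

(** The subtree of v and its complement are both trees of small reach. *)
Lemma sparse_cut v : v \in vset G -> v != x -> #|between G (D v) (vset G :\: D v)| < r.
Proof.
move=> vG vx; have DG := desc_vset G h par v.
apply: (few_between_reach girth_ge DG (subsetDl _ _) (disjointDr _ _)).
- by apply: (@reach_top v) => //; [exact: desc_refl | move=> u; exact: (desc_par Fo)].
- apply: (@reach_top x); first exact: subsetDl.
    rewrite inE xG andbT; apply: contra vx => /desc_height.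
    have := root_height Fo xG; rewrite set11 => /esym/eqP ->; rewrite leqn0.
    by rewrite -(root_height Fo vG) inE.
  move=> u /setDP[uG uv] ux; rewrite in_set1 ux; split=> //.
  by rewrite inE (par_vset Fo) // andbT; apply: contra uv; exact: (par_desc Fo).
- by rewrite /s0; have := leq_add_mul alpha_gt0 (ltnW r_ge2); nia.
Qed.

(** Every edge is cut by one of the subtrees, each of which cuts at most
    r - 1 edges, whereas there are at least 168 alpha r edges. *)
Lemma vset_ge : 168 * alpha < #|vset G|.
Proof.
have := @edges_off_core _ _ G _ _ _ Fo r.-1.
have -> : [set a in eset G | ~~ (ends G a \subset [set x])] = eset G.
  apply/setP=> a; rewrite !inE; have [aG|//] := boolP (a \in eset G).
  apply/negP=> /subset_leq_card; by rewrite cards1 card_ends.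
have -> : #|vset G :\: [set x]| = #|vset G|.-1 by rewrite [in RHS](cardsD1 x) xG.
move=> H; have {H} : #|eset G| <= r.-1 * #|vset G|.-1.
  apply: H => v vG; rewrite inE => vx; rewrite -ltnS prednK; last by lia.
  exact: sparse_cut.
case: r r_ge2 z_ge z_le => // r' _; rewrite /=.
have : 0 < #|vset G| by apply/card_gt0P; exists x.
case: #|vset G| => // n _; move: #|eset G| => e; nia.
Qed.

(** Let p be a vertex whose subtree is smallest among those with more than
    alpha vertices.  Then the subtrees of its children and the complement of its
    own subtree all have at most alpha vertices; these are the pieces.  A union
    A of pieces leaves p and all other pieces behind, which form a subtree of
    small reach.  So if A is connected and has between alpha and 2 alpha
    vertices, it sends out fewer than r edges, and loose connectivity bounds the
    number of vertices by 3 alpha + r. *)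
Lemma sparse_absurd : 2 * (alpha + r) < #|vset G| -> False.
Proof.
move=> n_gt; have n_ge := vset_ge.
have x0 : h x = 0 by have := root_height Fo xG; rewrite set11 => /esym/eqP.
have Dx : D x = vset G.
  apply/setP=> v; apply/idP/idP=> [/(subsetP (desc_vset _ _ _ _))//|vG].
  rewrite inE vG x0 leq0n subn0 /=.
  by rewrite -in_set1 (root_height Fo) ?(anc_vset Fo) // (height_anc Fo) // subnn.
have Dsub v : D v \subset vset G by exact: desc_vset.
have xa : (x \in vset G) && (alpha < #|D x|) by rewrite xG Dx; lia.
have [p /andP[pG pa] pmin] :=
  @arg_minnP _ x (fun p => (p \in vset G) && (alpha < #|D p|)) (fun p => #|D p|) xa.
have pD : p \in D p by exact: desc_refl.
have co_p : #|vset G :\: D p| <= alpha.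
  have [->|px] := eqVneq p x; first by rewrite Dx setDv cards0.
  have cut_p := sparse_cut pG px.
  have cD := cardsD (vset G) (D p); rewrite (setIidPr (Dsub p)) in cD.
  have [||le1] := loose_cut loose (Dsub p) _; [lia | lia | ].
  have DDp : vset G :\: (vset G :\: D p) = D p.
    by rewrite setDDr setDv set0U; apply/setIidPr.
  have := loose_cut loose (subsetDl (vset G) (D p)); rewrite DDp betweenC.
  by case=> [||le2]; lia.
pose c y := iter (h y - (h p).+1) par y.
pose piece y := if y \in D p then D (c y) else vset G :\: D p.
have cP y : y \in D p -> y != p ->
    [/\ c y \in D p, h (c y) = (h p).+1, y \in D (c y) & #|D (c y)| <= alpha].
  move=> yp y_p; have yG := subsetP (Dsub p) y yp.
  have hy : h p < h y.
    rewrite ltn_neqAle (desc_height yp) andbT; apply: contra y_p => /eqP hE.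
    by apply/eqP/esym; rewrite [LHS](descP yp) hE subnn.
  have hc : h (c y) = (h p).+1 by rewrite /c (height_anc Fo) // subKn.
  have yc : y \in D (c y) by apply: (desc_anc Fo yG); exact: leq_subr.
  have cp : c y \in D p by apply: (desc_comparable Fo) yc yp; rewrite ?hc.
  split=> //; rewrite leqNgt; apply/negP=> ca.
  have := pmin (c y); rewrite ca (subsetP (Dsub p)) // => /(_ isT).
  rewrite leqNgt => /negP; apply; apply: proper_card; apply/properP; split.
    exact: (desc_sub cp).
  by exists p => //; apply/negP=> /desc_height; rewrite hc ltnn.
have pN y : y \in D p -> y != p -> p \notin D (c y).
  by move=> yp y_p; apply/negP=> /desc_height; have [_ -> _ _] := cP y yp y_p; rewrite ltnn.
pose W := vset G :\ p.
have WP y : y \in W -> y \in vset G /\ y != p by rewrite !inE => /andP[].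
have [||||||||A [AW Ac Ap /andP[Aa Aa']]] := @grow V (adj G) W piece alpha.
- exact: adj_sym.
- move=> y /WP[yG y_p]; rewrite /piece; case: ifPn => yp; last by rewrite inE yp.
  by have [] := cP y yp y_p.
- move=> y /WP[yG y_p]; rewrite /piece; case: ifPn => yp; rewrite subsetD1.
    by rewrite Dsub pN.
  by rewrite subsetDl inE pD.
- move=> y /WP[yG y_p]; rewrite /piece; case: ifPn => yp.
    by have [cp _ _ _] := cP y yp y_p; apply: (desc_conn Fo); apply: (subsetP (Dsub p)).
  apply: (@connset_top _ _ _ _ _ _ Fo x); first exact: subsetDl.
    rewrite inE xG andbT; apply: contra yp => /desc_height; rewrite x0 leqn0 => /eqP p0.
    have -> : p = x by apply/eqP; rewrite -in_set1 (root_height Fo) ?p0.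
    by rewrite Dx.
  move=> u /setDP[uG up] ux; rewrite in_set1 ux; split=> //.
  by rewrite inE (par_vset Fo) // andbT; apply: contra up; exact: (par_desc Fo).
- move=> y /WP[yG y_p]; rewrite /piece; case: ifPn => yp //.
  by have [] := cP y yp y_p.
- move=> u y /WP[yG y_p]; rewrite /piece; case: (boolP (y \in D p)) => yp; last first.
    by rewrite inE => /andP[/negPf->].
  have [cp hc yc _] := cP y yp y_p => uc; have up := desc_trans uc cp.
  have u_p : u != p by apply: contraTneq uc => ->; exact: pN.
  have [_ hc' uc' _] := cP u up u_p; rewrite up.
  by congr D; apply: desc_eq uc' uc; rewrite hc.
- move=> P Q PQW PQ nPQ.
  have PW : P \subset W by rewrite -PQW subsetUl.
  have QW : Q \subset W by rewrite -PQW subsetUr.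
  apply: (loose_sep loose _ _ PQ nPQ).
  + exact: subset_trans PW (subsetDl _ _).
  + exact: subset_trans QW (subsetDl _ _).
  + by rewrite PQW setDDr setDv set0U (setIidPr _) ?sub1set // cards1; lia.
- have cW : #|vset G| = #|W|.+1 by rewrite (cardsD1 p) pG.
  rewrite -ltnS -cW (leq_ltn_trans _ n_ge) //; clear -alpha_gt0; lia.
have AG := subset_trans AW (subsetDl _ _).
have pA : p \notin A by apply/negP=> /(subsetP AW); rewrite !inE eqxx.
(* the complement of A contains the parents of its vertices, up to its top *)
have up_closed v : v \in vset G -> v \notin A -> v != x -> par v \in D p -> par v \notin A.
  move=> vG vA vx pvp; apply: contra vA => pvA.
  have pv_p : par v != p by apply: contraNneq pA => <-.
  have [_ _ pvc _] := cP (par v) pvp pv_p.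
  have := Ap (par v) pvA; rewrite /piece pvp => /subsetP; apply.
  apply: desc_trans pvc; apply: (@desc_anc _ _ _ _ _ _ Fo 1) => //.
  by rewrite lt0n -(root_height Fo vG) inE.
have few : #|between G A (vset G :\: A)| < r.
  apply: (few_between_reach girth_ge AG (subsetDl _ _) (disjointDr _ _) (reach_card Ac Aa')).
    have [/subsetP Ap'|/subsetPn[y yA yp]] := boolP (A \subset D p).
      apply: (@reach_top x); first exact: subsetDl.
        rewrite inE xG andbT; apply/negP=> xA.
        have := desc_height (Ap' x xA); rewrite x0 leqn0 => /eqP p0.
        by case/negP: pA; rewrite (_ : p = x) //; apply/eqP; rewrite -in_set1 (root_height Fo) ?p0.
      move=> v /setDP[vG vA] vx; rewrite in_set1 vx; split=> //.
      rewrite inE (par_vset Fo) // andbT; have [|np] := boolP (par v \in D p).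
        exact: up_closed.
      by apply: contra np; exact: Ap'.
    have coA : vset G :\: D p \subset A by have := Ap y yA; rewrite /piece (negPf yp).
    apply: (@reach_top p); [exact: subsetDl | by rewrite inE pA | ].
    move=> v /setDP[vG vA] vp.
    have vDp : v \in D p by apply: contraR vA => nvp; apply: (subsetP coA); rewrite inE nvp.
    have [vx pvp] := desc_par Fo vDp vp; split=> //.
    rewrite inE (par_vset Fo) // andbT; apply: up_closed => //.
    by rewrite in_set1 in vx.
  by rewrite /s0; have := leq_add_mul alpha_gt0 (ltnW r_ge2); nia.
have cA := cardsD (vset G) A; rewrite (setIidPr AG) in cA.
by have [||] := loose_cut loose AG _; lia.
Qed.

End Sparse.

Lemma many_far_vertices x : x \in vset G -> 2 * (alpha + r) < #|vset G :\: ball G (2 * R) [set x]|.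
Proof.
move=> xG; rewrite ltnNge; apply/negP=> near.
have [h [par Fo]] : exists h par, forest G [set x] h par.
  by apply: forest_exists; rewrite ?sub1set //; apply/set0Pn; exists x; rewrite set11.
have reach_t t P (PG : P \subset vset G) (tP : t \in P) hang :=
  @reach_top _ _ _ _ _ _ Fo r (2 * R) _ t P PG tP hang near.
have n_ge := vset_ge xG Fo reach_t.
have [n_le|] := leqP #|vset G| (2 * (alpha + r)); last exact: (sparse_absurd xG Fo reach_t).
exact: (dense_absurd Gc girth_ge loose).
Qed.

End Far.

(** * Branching inside clusters *)

(** A largest packing is dominating. *)
Lemma packing_exists (V E : finType) (G : mgraph V E) d : exists X : {set V},
  [/\ X \subset vset G, {in X &, forall x y, y \in ball G d [set x] -> x = y}
    & vset G \subset ball G d X].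
Proof.
pose sep (X : {set V}) := (X \subset vset G) &&
  [forall x in X, forall y in X, (y \in ball G d [set x]) ==> (x == y)].
have sep0 : sep set0.
  by rewrite /sep sub0set; apply/forall_inP=> x; rewrite inE.
have [X /andP[XG Xsep] Xmax] := @arg_maxnP _ set0 sep (fun X => #|X|) sep0.
have Xd : {in X &, forall x y, y \in ball G d [set x] -> x = y}.
  by move=> x y xX yX yx; have := implyP (forall_inP (forall_inP Xsep x xX) y yX) yx => /eqP.
exists X; split=> //; apply/subsetP=> v vG; apply: contraT => vX.
have far x : x \in X -> v \notin ball G d [set x].
  by move=> xX; apply: contra vX; apply/subsetP/ballSS; rewrite sub1set.
have nvX : v \notin X.
  by apply: contra vX; apply/subsetP; exact: (ball_mono G X (leq0n d)).
suff : sep (v |: X) by move/Xmax; rewrite /= cardsU1 nvX add1n ltnn.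
rewrite /sep subUset sub1set vG XG /=; apply/forall_inP=> x /setU1P[->|xX]; apply/forall_inP=> y /setU1P[->|yX]; apply/implyP; rewrite ?eqxx //.
- by rewrite ball_sym (negPf (far y yX)).
- by rewrite (negPf (far x xX)).
- by move/(Xd x y xX yX) ->.
Qed.

Section Clusters.
Variables (V E : finType) (G : mgraph V E) (r alpha z R : nat).
Implicit Types (P Q Z W A Y : {set V}).
Hypothesis Gc : connset (adj G) (vset G).
Hypothesis girth_ge : forall S : mgraph V E,
  subgraph S G -> minor (theta r) S -> z <= #|eset S|.
Hypothesis loose : loosely_connected alpha (2 * r - 1) G.
Hypotheses (r_ge2 : 2 <= r) (alpha_gt0 : 1 <= alpha).
Hypothesis z_ge : 168 * alpha * r <= z.
Hypothesis z_le : z <= #|eset G|.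
Hypothesis R_le : 8 * r * R <= z.

Variables (X : {set V}) (h : V -> nat) (par : V -> V).
Hypothesis XG : X \subset vset G.
Hypothesis Xsep : {in X &, forall x y, y \in ball G (2 * R) [set x] -> x = y}.
Hypothesis Xcover : vset G \subset ball G (2 * R) X.
Hypothesis Fo : forest G X h par.
Let D := desc G h par.

Lemma r_pos : 0 < r. Proof. exact: ltnW. Qed.

Lemma D_vset v : D v \subset vset G. Proof. exact: desc_vset. Qed.

Lemma root0 x : x \in X -> h x = 0.
Proof. by move=> xX; apply/eqP; rewrite -(root_height Fo) // (subsetP XG). Qed.

Lemma cluster_ball x u : x \in X -> u \in D x -> u \in ball G (h u) [set x].
Proof.
move=> xX; elim: {u}(h u) {-2}u (erefl (h u)) => [|n IH] u hu ux.
  by rewrite /= (descP ux) hu set11.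
have u_x : u != x by apply: contra_eq_neq hu => ->; rewrite root0.
have [uX pux] := desc_par Fo ux u_x; have uG := subsetP (D_vset x) u ux.
have := par_height Fo uG uX; rewrite hu => -[/esym hp].
by have := IH _ hp pux; rewrite hp => /ball_step; apply; rewrite adj_sym (par_adj Fo).
Qed.

Lemma cluster_cover v : v \in vset G -> exists2 x, x \in X & v \in D x.
Proof.
move=> vG; exists (iter (h v) par v); last exact: (desc_anc Fo).
by rewrite (root_height Fo) ?(anc_vset Fo) // (height_anc Fo) // subnn.
Qed.

Lemma cluster_disj x y v : x \in X -> y \in X -> v \in D x -> v \in D y -> x = y.
Proof. by move=> xX yX; apply: desc_eq; rewrite !root0. Qed.

(** Otherwise the roots of the two clusters would be joined by a path of
    length at most 2R. *)
Lemma exit_height x u w : x \in X -> u \in D x -> w \notin D x -> adj G u w -> R <= h u.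
Proof.
move=> xX ux wx uw; have [uG wG] := adj_vset uw.
have [y yX wy] := cluster_cover wG; rewrite leqNgt; apply/negP=> hu.
have xy : x = y; last by rewrite xy wy in wx.
apply: Xsep => //; have hw := adj_height Fo uw.
have w_x : w \in ball G (h u).+1 [set x] by apply: ball_step uw; exact: cluster_ball.
have y_w : y \in ball G (h w) [set w] by rewrite ball_sym cluster_ball.
apply: (subsetP (ball_mono _ _ _)) (ball_trans w_x y_w).
by move: hu hw; clear; lia.
Qed.

Lemma reach_hang t P : P \subset vset G -> t \in P ->
    (forall v, v \in P -> v != t -> v \notin X /\ par v \in P) ->
  reach G r (r * (2 * R).+1 + 0 + 1) P.
Proof.
move=> PG tP hang; apply: (reach_top Fo PG tP hang).
by move: Xcover; rewrite -setD_eq0 => /eqP ->; rewrite cards0.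
Qed.

Lemma reach_desc v : v \in vset G -> reach G r (r * (2 * R).+1 + 0 + 1) (D v).
Proof.
move=> vG; apply: (@reach_hang v); [exact: D_vset | exact: desc_refl | ].
by move=> u; exact: (desc_par Fo).
Qed.

Lemma few_hang P Q : P \subset vset G -> Q \subset vset G -> [disjoint P & Q] ->
    reach G r (r * (2 * R).+1 + 0 + 1) P -> reach G r (r * (2 * R).+1 + 0 + 1) Q ->
  #|between G P Q| < r.
Proof.
move=> PG QG PQ Pr Qr; apply: (few_between_reach girth_ge PG QG PQ Pr Qr).
have := leq_add_mul alpha_gt0 r_pos; clear -z_ge R_le alpha_gt0 r_ge2; nia.
Qed.

Lemma few_clusters x y : x \in X -> y \in X -> x != y -> #|between G (D x) (D y)| < r.
Proof.
move=> xX yX xy; apply: few_hang; rewrite ?D_vset //.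
- apply: disjoint_mem => v vx; apply: contra xy => vy; apply/eqP.
  exact: cluster_disj vx vy.
- by apply: reach_desc; apply: (subsetP XG).
- by apply: reach_desc; apply: (subsetP XG).
Qed.

Lemma few_below x v : x \in X -> v \in D x -> #|between G (D v) (D x :\: D v)| < r.
Proof.
move=> xX vx; have vG := subsetP (D_vset x) v vx; have xG := subsetP XG x xX.
have [->|v_x] := eqVneq v x.
  rewrite setDv (_ : between _ _ _ = set0) ?cards0 ?r_pos //.
  by apply/setP=> a; rewrite !inE setI0 eqxx !andbF.
apply: few_hang; rewrite ?D_vset ?disjointDr //.
- exact: subset_trans (subsetDl _ _) (D_vset x).
- exact: reach_desc.
apply: (@reach_hang x); first exact: subset_trans (subsetDl _ _) (D_vset x).
  rewrite in_setD (desc_refl _ _ xG) andbT; apply: contra v_x => xv.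
  have := desc_height xv; rewrite (root0 xX) leqn0 => /eqP hv.
  by rewrite [x](descP vx) hv sub0n.
move=> u /setDP[ux uv] u_x; have [uX pu] := desc_par Fo ux u_x; split=> //.
rewrite in_setD pu andbT; apply: contra uv; apply: (par_desc Fo).
exact: (subsetP (D_vset x)).
Qed.

(** The slice below v and not below p contains the path from p up to v, hence
    more than alpha vertices.  Without an edge to another cluster, it would be
    separated from the rest by the cuts of v and p within the cluster, which
    have fewer than r edges each. *)
Lemma slice_exit x v p : x \in X -> v \in D x -> p \in D v -> h p = h v + alpha.+1 ->
  exists u w, [/\ u \in D v, u \notin D p, w \notin D x & adj G u w].
Proof.
move=> xX vx pv hp; set S := D v :\: D p.
have [/nbP[u [w [/setDP[uv up] /setDP[_ wx] uw]]]|nb0] := boolP (nb (adj G) S (vset G :\: D x)).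
  by exists u, w.
exfalso.
have Dvx : D v \subset D x := desc_sub vx.
have pG := subsetP (D_vset v) p pv.
have SG : S \subset vset G by exact: subset_trans (subsetDl _ _) (D_vset v).
have cutS : between G S (vset G :\: S) \subset
    between G (D v) (D x :\: D v) :|: between G (D p) (D x :\: D p).
  apply/subsetP=> a /(betweenP _ _ (disjointDr _ _))[u [w [/setDP[uv up] /setDP[wG wS] aG aE]]].
  have uw : adj G u w by apply/adjP; exists a.
  have wx : w \in D x.
    apply: contraNT nb0 => wx; apply/nbP; exists u, w; split=> //; first by rewrite in_setD up.
    by rewrite in_setD wx.
  have [wp|wp] := boolP (w \in D p).
    apply/setUP; right; apply/(betweenP _ _ (disjointDr _ _)).
    exists w, u; split=> //; last by rewrite setUC.
    by rewrite in_setD up (subsetP Dvx).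
  apply/setUP; left; apply/(betweenP _ _ (disjointDr _ _)).
  exists u, w; split=> //; rewrite in_setD wx andbT.
  by apply: contra wS => wv; rewrite in_setD wp.
have few : #|between G S (vset G :\: S)| <= 2 * r - 2.
  apply: leq_trans (subset_leq_card cutS) _.
  apply: leq_trans (leq_card_setU _ _).1 _.
  have := few_below xX vx; have := few_below xX (subsetP Dvx p pv); clear; lia.
have S_gt : alpha < #|S|.
  pose f (j : 'I_alpha.+1) := iter j.+1 par p.
  have finj : injective f.
    move=> i j fij; apply: ord_inj; have := congr1 h fij.
    rewrite !(height_anc Fo) // hp; have := ltn_ord i; have := ltn_ord j; clear.
    by move: (h v) (nat_of_ord i) (nat_of_ord j) => a b c; lia.
  rewrite -[alpha.+1]card_ord -(card_imset _ finj); apply: subset_leq_card.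
  apply/subsetP=> u /imsetP[j _ ->]; have fG : f j \in vset G by exact: (anc_vset Fo).
  have hf : h (f j) = h p - j.+1 by rewrite (height_anc Fo).
  have jl := ltn_ord j; rewrite in_setD; apply/andP; split.
    by apply/negP=> /desc_height; rewrite hf hp; move: jl; clear; lia.
  apply: (desc_comparable Fo (subsetP (D_vset x) v vx) _ _ pv).
    by rewrite hf hp; move: jl; clear; lia.
  by apply: (desc_anc Fo pG); rewrite hp; move: jl; clear; lia.
have xG := subsetP XG x xX.
have big : 2 * (alpha + r) < #|vset G :\: S|.
  apply: leq_trans (many_far_vertices Gc girth_ge loose r_ge2 alpha_gt0 z_ge z_le R_le xG) _.
  apply: subset_leq_card; apply: setDS; apply/subsetP=> u /setDP[/(subsetP Dvx) ux _].
  have uG := subsetP (D_vset x) u ux.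
  apply: (subsetP (ball_mono _ _ _)) (cluster_ball xX ux).
  by rewrite -(height_ball Fo) // (subsetP Xcover).
have lt : #|between G S (vset G :\: S)| < 2 * r - 1 by move: few r_pos; clear; lia.
have := loose_cut loose SG lt; move: S_gt few big; clear; lia.
Qed.

(** Each exit of the slice comes from a vertex u of height at least R that is
    not below p.  The ancestors p and q of w and u at height h v + alpha + 1
    are then different, and both carry branches down to height R, so induction
    applies to their disjoint subtrees. *)
Lemma many_exits x m v w : x \in X -> v \in D x -> w \in D v ->
    h v + m.+1 * alpha.+1 <= R -> h v + m.+1 * alpha.+1 <= h w ->
  2 ^ m <= #|between G (D v) (vset G :\: D x)|.
Proof.
move=> xX; elim: m v w => [|m IH] v w vx wv hR hw.
  all: have wG := subsetP (D_vset v) w wv.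
  all: have vG := subsetP (D_vset x) v vx.
  all: pose p := iter (h w - (h v + alpha.+1)) par w.
  all: have hp : h p = h v + alpha.+1 by rewrite (height_anc Fo) // subKn // (leq_trans _ hw) // leq_add2l leq_pmull.
  all: have wp : w \in D p by apply: (desc_anc Fo) => //; exact: leq_subr.
  all: have pv : p \in D v by apply: (desc_comparable Fo vG _ wp wv); rewrite hp leq_addr.
  all: have [u [o [uv up ox uo]]] := slice_exit xX vx pv hp.
  all: have ux := subsetP (desc_sub vx) u uv.
  all: have [uG oG] := adj_vset uo.
  rewrite expn0 card_gt0 -nb_between; last exact: disjointWl (desc_sub vx) (disjointDr _ _).
  by apply/nbP; exists u, o; rewrite in_setD ox oG.
have uR := exit_height xX ux ox uo.
pose q := iter (h u - (h v + alpha.+1)) par u.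
have le2 : h v + alpha.+1 <= h u by apply: leq_trans uR; apply: leq_trans hR; rewrite leq_add2l leq_pmull.
have hq : h q = h v + alpha.+1 by rewrite (height_anc Fo) // subKn.
have uq : u \in D q by apply: (desc_anc Fo) => //; exact: leq_subr.
have qv : q \in D v by apply: (desc_comparable Fo vG _ uq uv); rewrite hq leq_addr.
have step p' : h p' = h v + alpha.+1 -> h p' + m.+1 * alpha.+1 = h v + m.+2 * alpha.+1.
  by move->; rewrite -addnA -mulSn.
have px := subsetP (desc_sub vx) p pv; have qx := subsetP (desc_sub vx) q qv.
have np := IH p w px wp; rewrite step // in np; have {}np := np hR hw.
have nq := IH q u qx uq; rewrite step // in nq; have {}nq := nq hR (leq_trans hR uR).
rewrite expnS mul2n -addnn; apply: leq_trans (leq_add np nq) _.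
have pq : p != q by apply: contraNneq up => ->.
have dis : [disjoint between G (D p) (vset G :\: D x) & between G (D q) (vset G :\: D x)].
  apply: disjoint_mem => a ap; apply/negP=> aq.
  have outD y : y \in D x -> [disjoint D y & vset G :\: D x].
    by move=> yx; apply: disjointWl (desc_sub yx) (disjointDr _ _).
  have /(betweenP _ _ (outD p px))[a1 [b1 [a1p b1x aG aE1]]] := ap.
  have /(betweenP _ _ (outD q qx))[a2 [b2 [a2q b2x _ aE2]]] := aq.
  have : a2 \in [set a1; b1] by rewrite -aE1 aE2 !inE eqxx.
  case/set2P=> a2E; first by case/eqP: pq; apply: desc_eq a1p _; rewrite ?hp // -a2E.
  by move/setDP: b1x; rewrite -a2E (subsetP (desc_sub qx)) // => -[].
rewrite -(eqP (etrans (leq_card_setU _ _).2 dis)); apply: subset_leq_card.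
by rewrite subUset !betweenS ?desc_sub.
Qed.

(** A cluster without exits would be the whole graph, with all vertices within
    distance 2R of its root; any exit provides a vertex of height at least R. *)
Lemma cluster_exits x m : x \in X -> m.+1 * alpha.+1 <= R ->
  2 ^ m <= #|between G (D x) (vset G :\: D x)|.
Proof.
move=> xX mR; have xG := subsetP XG x xX.
have xx : x \in D x by exact: desc_refl.
have [/subsetP all_x|/subsetPn[o oG ox]] := boolP (vset G \subset D x).
  have := many_far_vertices Gc girth_ge loose r_ge2 alpha_gt0 z_ge z_le R_le xG.
  suff -> : vset G :\: ball G (2 * R) [set x] = set0 by rewrite cards0.
  apply/eqP; rewrite setD_eq0; apply/subsetP=> u /[dup] uG /all_x ux.
  apply: (subsetP (ball_mono _ _ _)) (cluster_ball xX ux).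
  by rewrite -(height_ball Fo) // (subsetP Xcover).
have [u [w [uG ux wG wx uw]]] := connset_cross Gc xG xx oG ox.
have hu := exit_height xX ux wx uw.
by apply: (@many_exits x m x u) => //; rewrite root0 //; apply: leq_trans hu.
Qed.

Lemma cluster_degree x d m : x \in X -> m.+1 * alpha.+1 <= R -> d * r.-1 <= 2 ^ m ->
  d <= #|nbrs (touch G) [set D y | y in X] (D x)|.
Proof.
move=> xX mR dm; rewrite -(@leq_pmul2r r.-1); last by rewrite ltn_predRL.
apply: leq_trans dm _; apply: leq_trans (cluster_exits xX mR) _.
set N := nbrs _ _ _; apply: leq_trans (card_bigcup_le (A := N) (F := fun Q => between G (D x) Q) _); last first.
  move=> Q; rewrite inE => /andP[/imsetP[y yX ->] /andP[xy _]].
  rewrite -ltnS (prednK r_pos); apply: few_clusters => //.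
  by apply: contraNneq xy => ->.
apply: subset_leq_card; apply/subsetP=> a /(betweenP _ _ (disjointDr _ _)).
move=> [u [w [ux /setDP[wG wx] aG aE]]]; have [y yX wy] := cluster_cover wG.
have xy : D x != D y by apply: contraNneq wx => ->.
apply/bigcupP; exists (D y).
  rewrite inE imset_f //= /touch xy; apply/nbP; exists u, w; split=> //.
  by apply/adjP; exists a.
rewrite inE aG aE /=; apply/andP; split; apply/set0Pn; [exists u | exists w];
  by rewrite in_setI in_set2 eqxx ?orbT ?in_setD ?wx.
Qed.

Lemma clusters_family : branch_family G [set D x | x in X].
Proof.
apply/branch_familyP; split.
- move=> P Q /imsetP[x xX ->] /imsetP[y yX ->] v vx vy; congr D.
  exact: cluster_disj vx vy.
- by move=> P /imsetP[x xX ->]; apply: (desc_conn Fo); apply: (subsetP XG).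
- by move=> P /imsetP[x xX ->]; exact: D_vset.
Qed.

End Clusters.

Lemma clique_minor_of_theta_girth (V E : finType) (G : mgraph V E) (r alpha z m k : nat) :
    connected_mgraph G -> 2 <= r -> 1 <= alpha -> 168 * alpha * r <= z -> z <= #|eset G| ->
    loosely_connected alpha (2 * r - 1) G ->
    (forall S : mgraph V E, subgraph S G -> minor (theta r) S -> z <= #|eset S|) ->
    8 * r * (m.+1 * alpha.+1) <= z ->
    12 * (k * k + k + 2) * r.-1 <= 2 ^ m ->
  minor (clique k) G.
Proof.
move=> Gconn r2 a1 z_ge z_le loose girth_ge mz km.
have E0 : eset G != set0.
  rewrite -card_gt0 (leq_trans _ z_le) // (leq_trans _ z_ge) // !muln_gt0 a1 /=.
  exact: ltnW.
have V0 : vset G != set0.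
  have [a aG] := set0Pn _ E0; have /cards2P[u [w [_ aE]]] : #|ends G a| == 2 by rewrite card_ends.
  by apply/set0Pn; exists u; apply: (ends_vset aG); rewrite aE !inE eqxx.
have Gc := connset_vset Gconn V0; set R := m.+1 * alpha.+1 in mz.
have [X [XG Xsep Xcover]] := packing_exists G (2 * R).
have X0 : X != set0.
  apply: contra_neq V0 => X0; apply/eqP; rewrite -subset0 -X0 (subset_trans Xcover) // X0.
  by elim: (2 * R) => //= i /thickenS/subset_trans; apply; apply/subsetP=> v; rewrite !inE => /exists_inP[u]; rewrite inE.
have [h [par Fo]] := forest_exists Gc XG X0.
apply: (@clique_of_family _ _ G [set desc G h par x | x in X] (12 * (k * k + k + 2))) => //.
- exact: clusters_family.
- by have [x xX] := set0Pn _ X0; apply/set0Pn; exists (desc G h par x); exact: imset_f.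
- move=> P /imsetP[x xX ->].
  exact: (@cluster_degree _ _ G r alpha z R Gc girth_ge loose r2 a1 z_ge z_le mz X h par XG Xsep Xcover Fo x _ m).
Qed.

(** * Choice of the exponent *)

From mathcomp Require Import all_boot all_order all_algebra.
From mathcomp Require Import classical_sets reals constructive_ereal ereal.
From mathcomp Require Import topology normedtype exp.
From mathcomp Require Import ring lra.

Import Order.TTheory GRing.Theory Num.Theory.
Local Open Scope ring_scope.

Lemma girth_le (R : realType) (V E V' E' : finType) (H : mgraph V' E') (G S : mgraph V E) (z : nat) :
  (z%:R%:E <= girth R H G)%E -> subgraph S G -> minor H S -> (z <= #|eset S|)%N.
Proof.
move=> zG SG HS; rewrite -(ler_nat R) -lee_fin; apply: le_trans zG _.
by apply: ereal_inf_lbound; exists S.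
Qed.

(** The binary logarithm of r is at least 1. *)
Lemma nat_bound_of_log (R : realType) (r alpha z : nat) : (2 <= r)%N ->
  168 * alpha%:R * r%:R * log2 (r%:R : R) <= z%:R -> (168 * alpha * r <= z)%N.
Proof.
move=> r2 le; rewrite -(ler_nat R); apply: le_trans le; rewrite !natrM ler_peMr //.
have ln2 : 0 < ln (2 : R) by rewrite ln_gt0 // ltr1n.
by rewrite /log2 ler_pdivlMr // mul1r ler_ln ?posrE ?ltr0n ?ler_nat // (leq_trans _ r2).
Qed.

(** m + 1 is the number of slices of thickness alpha + 1 that fit into the
    height z / (8 r). *)
Lemma branching_depth (r alpha z : nat) : (2 <= r)%N -> (1 <= alpha)%N -> (168 * alpha * r <= z)%N ->
  exists m, (8 * r * (m.+1 * alpha.+1) <= z)%N /\ (z <= 16 * (r * alpha) * m.+2)%N.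
Proof.
move=> r2 a1 zr; pose q := (z %/ (8 * r))%N; pose M := (q %/ alpha.+1)%N.
have r8 : (0 < 8 * r)%N by rewrite muln_gt0 (leq_trans _ r2).
have M_gt0 : (0 < M)%N by rewrite divn_gt0 // leq_divRL //; nia.
(* rounding down twice costs one more slice in the upper bound *)
exists M.-1; rewrite prednK //; split.
  apply: leq_trans (leq_divM z (8 * r)); rewrite [leqRHS]mulnC leq_mul2l.
  by rewrite leq_divM orbT.
have zq : (z < q.+1 * (8 * r))%N := ltn_ceil z r8.
have qM : (q < M.+1 * alpha.+1)%N := ltn_ceil q (ltn0Sn alpha).
apply: leq_trans (ltnW zq) _; apply: leq_trans (leq_mul qM (leqnn _)) _.
rewrite (_ : 16 * (r * alpha) * M.+1 = M.+1 * (2 * alpha) * (8 * r))%N; last by ring.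
by rewrite !leq_mul // mul2n -addnn -addn1 leq_add2l.
Qed.

(** With x = z / (r alpha) and u = 2 ^ (x / 32), the bound on k gives
    k^2 r <= 4 u / z, while 2^m >= u^2 / 4; the remaining numerical factors are
    covered by u >= 2 and z >= 336. *)
Lemma clique_order_bound (R : realType) (r alpha z m k : nat) : (2 <= r)%N -> (1 <= alpha)%N ->
    (168 * alpha * r <= z)%N -> (z <= 16 * (r * alpha) * m.+2)%N -> (2 <= k)%N ->
    (k%:R : R) <= 2 * (2 `^ (64^-1 * (z%:R / (r%:R * alpha%:R))) / Num.sqrt (r%:R * z%:R)) ->
  (12 * (k * k + k + 2) * r.-1 <= 2 ^ m)%N.
Proof.
move=> r2 a1 zr zm k2; set x : R := z%:R / _; set t : R := _ / _ => kt.
have r_gt0 : 0 < r%:R :> R by rewrite ltr0n (leq_trans _ r2).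
have a_gt0 : 0 < alpha%:R :> R by rewrite ltr0n.
have z336 : 336 <= z%:R :> R by rewrite (ler_nat R 336); nia.
have z_gt0 : 0 < z%:R :> R by apply: lt_le_trans z336; rewrite ltr0n.
have ra_gt0 : 0 < r%:R * alpha%:R :> R by exact: mulr_gt0.
have x168 : 168 <= x.
  rewrite ler_pdivlMr //; move: zr; rewrite -(ler_nat R) !natrM.
  by move/(le_trans _); apply; rewrite -mulrA [alpha%:R * _]mulrC.
have xm : x / 16 - 2 <= m%:R.
  have : x <= 16 * (m%:R + 2).
    rewrite ler_pdivrMr //; move: zm; rewrite -(ler_nat R) !natrM -[m.+2]addn2 natrD.
    by move/le_trans; apply; rewrite mulrAC.
  lra.
pose u : R := 2 `^ (x / 32).
have u2 : 2 <= u.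
  rewrite -[leLHS]powRr1 // /u ler_powR ?ler1n //; lra.
have tE : t ^+ 2 = u / (r%:R * z%:R).
  rewrite /t expr_div_n sqr_sqrtr ?mulr_ge0 ?ler0n // -powR_mulrn ?powR_ge0 // -powRrM.
  by congr (2 `^ _ / _); clear; lra.
have le12 : 1 <= 2 :> R by rewrite ler1n.
have mE : u ^+ 2 / 4 <= 2 ^+ m.
  rewrite -[leRHS]powR_mulrn ?ler0n //; apply: le_trans (ler_powR le12 xm).
  rewrite powRD ?pnatr_eq0 ?implybT // powRN (powR_mulrn 2) ?ler0n //.
  rewrite /u -[X in X / _]powR_mulrn ?powR_ge0 // -powRrM.
  have -> : x / 32 * 2 = x / 16 by clear; lra.
  by rewrite -natrX.
have kk : (12 * (k * k + k + 2) * r.-1 <= 24 * (k * k) * r)%N.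
  by rewrite leq_mul ?leq_pred //; move: k2; clear; nia.
rewrite -(ler_nat R) natrX; apply: le_trans mE.
apply: le_trans (_ : (24 * (k * k) * r)%:R <= _); first by rewrite ler_nat.
have t_ge0 : 0 <= t by rewrite divr_ge0 ?powR_ge0 ?sqrtr_ge0.
have k2t : k%:R ^+ 2 <= 4 * t ^+ 2.
  by rewrite (_ : 4 * t ^+ 2 = (2 * t) ^+ 2); [rewrite ler_pXn2r ?nnegrE ?ler0n ?mulr_ge0 | ring].
rewrite !natrM -expr2; apply: le_trans (_ : 24 * (4 * t ^+ 2) * r%:R <= _).
  by rewrite ler_wpM2r ?ler0n // ler_wpM2l.
rewrite tE.
have -> : 24 * (4 * (u / (r%:R * z%:R))) * r%:R = 96 * u / z%:R.
  by field; rewrite !gt_eqF.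
rewrite ler_pdivrMr //.
have u_ge0 : 0 <= u by apply: le_trans u2.
have uz : 2 * 336 <= u * z%:R by apply: (ler_pM _ _ u2 z336); rewrite ler0n.
have := ler_wpM2l u_ge0 uz.
have -> : u ^+ 2 / 4 * z%:R = u * (u * z%:R) / 4 by ring.
by move: (u * (u * _)) => w; clear -u_ge0; lra.
Qed.

Theorem theorem1p2 (R : realType) :
  exists2 c : R, 0 < c &
    forall r alpha z : nat,
      (2 <= r)%N -> (1 <= alpha)%N ->
      168 * alpha%:R * r%:R * log2 (r%:R : R) <= z%:R ->
    forall (V E : finType) (G : mgraph V E),
      connected_mgraph G ->
      (z <= #|eset G|)%N ->
      loosely_connected alpha (2 * r - 1)%N G ->
      (z%:R%:E <= girth R (theta r) G)%E ->
    exists2 k : nat,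
      minor (clique k) G
      & 2 `^ (c * (z%:R / (r%:R * alpha%:R))) / Num.sqrt (r%:R * z%:R) <= k%:R.
Proof.
exists 64^-1; first by rewrite invr_gt0 ltr0n.
move=> r alpha z r2 a1 /(nat_bound_of_log r2) zr V E G Gconn ze loose zG.
set t : R := _ / Num.sqrt _; have [t1|t1] := leP t 1.
  (* a single vertex is enough *)
  exists 1%N; last exact: t1.
  have E0 : eset G != finset.set0.
    by rewrite -card_gt0 (leq_trans _ ze) // (leq_trans _ zr) // !muln_gt0 a1 (leq_trans _ r2).
  have [a aG] := finset.set0Pn _ E0.
  have /cards2P[v [w [_ aE]]] : #|ends G a| == 2%N by rewrite card_ends.
  apply: (@clique_minor _ _ G 1 (fun=> [set v]%SET)) => //.
  - by move=> _; rewrite finset.sub1set; apply: (ends_vset aG); rewrite aE !inE eqxx.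
  - by move=> _; apply: connset1; exact: adj_sym.
  - by move=> i j; rewrite !ord1.
  - by move=> i j; rewrite !ord1 eqxx.
(* for t > 1, rounding up at most doubles t *)
have t0 : 0 <= t := le_trans ler01 (ltW t1).
have /andP[kt tk] := truncn_itv t0; exists (Num.truncn t).+1; last exact: ltW.
have [m [mz zm]] := branching_depth r2 a1 zr.
apply: (clique_minor_of_theta_girth (z := z) Gconn r2 a1 zr ze loose _ mz).
  by move=> S; exact: girth_le zG.
apply: (clique_order_bound r2 a1 zr zm (R := R)).
  by rewrite ltnS lt0n; apply: contraTneq tk => ->; rewrite -leNgt ltW.
by rewrite -/t -natr1; move: kt t1; clear; lra.
Qed.
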